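(* There exist infinitely many pairwise nonisomorphic fields $K$ of characteristic not $2$, each of which satisfies both of the following properties: (1) $\mathrm{Quat}^*(K)$ is infinite; and (2) the algebras in $\mathrm{Quat}^*(K)$ are pairwise weakly isomorphic.
   Context: For a field $K$ of characteristic not $2$, $\mathrm{Quat}^*(K)$ denotes the set of isomorphism classes (as $K$-algebras) of quaternion division algebras with center $K$. For a division algebra $D$ with center $K$, finite-dimensional over $K$, the maximal subfields of $D$ are the maximal elements of the poset of fields $E$ with $K\subset E\subset D$, and $\mathrm{Max}(D)$ is the set of isomorphism classes (as field extensions of $K$) of maximal subfields of $D$. Two division algebras $D,D'$ with center $K$ are weakly isomorphic if $\mathrm{Max}(D)=\mathrm{Max}(D')$. *)

(* Defs.v *)
From HB Require Import structures.
From mathcomp Require Import all_boot all_algebra all_field.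

Set Implicit Arguments.
Unset Strict Implicit.
Unset Printing Implicit Defensive.

Import GRing.Theory.
Local Open Scope ring_scope.

Definition field_isomorphic (K L : fieldType) : Prop :=
  exists f : {rmorphism K -> L}, bijective f.

(* A set of isomorphism classes is represented by the isomorphism-invariant
   predicate it defines: [set (set (falgType K))] is not available, for universe
   reasons.  Such a set is infinite when it contains a sequence of pairwise
   distinct classes. *)
Definition infinite_up_to (T : Type) (iso : T -> T -> Prop) (P : T -> Prop) :
    Prop :=
  exists f : nat -> T,
    (forall n, P (f n)) /\ (forall m n, m <> n -> ~ iso (f m) (f n)).

Definition alg_isomorphic (K : fieldType) (A B : falgType K) : Prop :=
  exists f : {lrmorphism A -> B}, bijective f.

(* [falgType K] already gives finite dimension and [1 != 0]; [1%VS] is the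
   line K.1. *)
Definition central_division_algebra (K : fieldType) (D : falgType K) : Prop :=
  (forall x : D, x != 0 -> x \is a GRing.unit) /\
  'Z({:D})%VS = 1%VS :> {vspace D}.

(* The algebra (a, b)_K; this is the usual definition only when K has
   characteristic different from 2. *)
Definition quaternion_algebra (K : fieldType) (D : falgType K) : Prop :=
  exists (a b : K) (i j : D),
    [/\ a != 0 /\ b != 0, i ^+ 2 = a%:A, j ^+ 2 = b%:A, j * i = - (i * j)
      & basis_of {:D} [:: 1; i; j; i * j]].

(* Quat^*(K): its classes are those of the algebras D satisfying [Quat D]. *)
Definition Quat (K : fieldType) (D : falgType K) : Prop :=
  quaternion_algebra D /\ central_division_algebra D.

(* [1 <= E] says that E contains K; a member of {aspace D} alone need not have
   the unit of D as its identity. *)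
Definition subfield_over (K : fieldType) (D : falgType K) (E : {aspace D}) :
    Prop :=
  [/\ (1 <= E)%VS,
      {in E &, forall x y : D, x * y = y * x}
    & {in E, forall x : D, x != 0 -> x \is a GRing.unit /\ x^-1 \in E}].

Definition maximal_subfield (K : fieldType) (D : falgType K) (E : {aspace D}) :
    Prop :=
  subfield_over E /\
  forall F : {aspace D}, subfield_over F -> (E <= F)%VS ->
    F = E :> {vspace D}.

(* [Max D L]: the isomorphism class of L belongs to Max(D).  Isomorphism of
   field extensions of K is isomorphism of K-algebras. *)
Definition Max (K : fieldType) (D L : falgType K) : Prop :=
  exists E : {aspace D},
    maximal_subfield E /\ alg_isomorphic (subvs_of E : falgType K) L.

Definition weakly_isomorphic (K : fieldType) (D D' : falgType K) : Prop :=
  forall L : falgType K, Max D L <-> Max D' L.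

(* Main.v *)
From HB Require Import structures.
Require Import Defs.
From mathcomp Require Import all_boot all_algebra all_field.
From mathcomp Require Import boolp ring zify.

(** Say that c is a slot of the quaternion algebra (a, b) when the pure form
    <a, b, -ab> represents c, that is, when c is the square of a pure
    quaternion.  The idea is to build K so that every nonsquare of K is a slot
    of every algebra (a, b).  Then a quaternion division algebra over K contains
    a copy of every quadratic extension of K.  Its maximal subfields are
    quadratic, since a pure quaternion commutes only with the combinations of 1
    and itself.  So Max(D) consists of all quadratic extensions of K, whatever
    D is ([Max_transfer]).

    The key step ([slot_not_represented], [slot_extension]) is that c can be
    made a slot of (a, b), for a, b nonzero and c nonsquare in K, without
    splitting a single quaternion division algebra (d, e) over K.  The extension
    L is the function field of the quadric a X^2 + b Y^2 - a b Z^2 = c, realized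
    as K(x)(y)(sqrt g) with g = a y^2 + (c - a x^2) / b.  Suppose that (d, e)
    splits over L.  Then its pure form phi = <d, e, -de> represents g over
    K(x)(y), and the Cassels-Pfister theorem ([cassels_pfister]) in the variable
    y gives orthogonal vectors v0, v1 over K(x) with phi(v1) = a and
    phi(v0) = (c - a x^2) / b.  The theorem in the variable x gives a vector w
    over K with phi(w) = a, a reflection carries v1 to w, and the theorem in x
    again, now inside the orthogonal complement of w, replaces v0 by s0 + s1 x
    with s0, s1 over K.  Thus w, s0, s1 is an orthogonal basis of K^3 on which
    phi takes the values a, c / b and - a / b.  The discriminant of phi is - 1
    up to squares, so c is a square, a contradiction.

    Iterating the key step along a countable tower of countable fields and
    passing to the direct limit gives, from any countable K0 of characteristic
    not 2, an extension K with the slot property in which the division algebras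
    (d, e) of K0 stay division algebras ([slot_closure]).  For an odd prime p
    the construction starts from K0 = k(x)(t), where k is a countable field of
    characteristic p with distinct elements r_0, r_1, ...  The algebras
    (x - r_n, t) and, for m <> n, ((x - r_m) (x - r_n), t) are division algebras
    over K0 ([independent_symbols]), hence over K.  An isomorphism between
    (x - r_m, t) and (x - r_n, t) would split ((x - r_m) (x - r_n), t)
    ([common_slot_split]), so the algebras (x - r_n, t) are pairwise
    nonisomorphic over K.  Distinct primes p give
    nonisomorphic fields K. *)

Set Implicit Arguments.
Unset Strict Implicit.
Unset Printing Implicit Defensive.

Import GRing.Theory.
Local Open Scope ring_scope.

(** * Diagonal forms and the Cassels-Pfister theorem *)

Section DiagonalForm.
Variables (R : comNzRingType) (n : nat).
Implicit Types c l u v : 'I_n -> R.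

Definition qf c v := \sum_i c i * v i ^+ 2.
Definition bf c u v := \sum_i c i * (u i * v i).

Lemma qfD c a b u v :
  qf c (fun i => a * u i + b * v i)
  = a ^+ 2 * qf c u + a * b * bf c u v *+ 2 + b ^+ 2 * qf c v.
Proof.
rewrite /qf /bf !mulr_sumr -sumrMnl -!big_split /=.
by apply: eq_bigr => i _; ring.
Qed.

Lemma bfDl c a b u v w :
  bf c (fun i => a * u i + b * v i) w = a * bf c u w + b * bf c v w.
Proof.
rewrite /bf !mulr_sumr -!big_split /=.
by apply: eq_bigr => i _; ring.
Qed.

Lemma bfC c u v : bf c u v = bf c v u.
Proof. by apply: eq_bigr => i _; rewrite (mulrC (u i)). Qed.

Lemma bfE c v : bf c v v = qf c v.
Proof. by apply: eq_bigr => i _; rewrite expr2. Qed.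

Lemma eq_qf c v v' : v =1 v' -> qf c v = qf c v'.
Proof. by move=> e; apply: eq_bigr => i _; rewrite e. Qed.

Lemma qfZ c a v : qf c (fun i => v i * a) = qf c v * a ^+ 2.
Proof. by rewrite /qf mulr_suml; apply: eq_bigr => i _; ring. Qed.

Definition anisotropic c := forall v, qf c v = 0 -> forall i, v i = 0.

End DiagonalForm.

Lemma rmorph_qf (R S : comNzRingType) (f : {rmorphism R -> S}) n c v :
  f (@qf R n c v) = qf (f \o c) (f \o v).
Proof.
by rewrite rmorph_sum; apply: eq_bigr => i _; rewrite rmorphM rmorphXn.
Qed.

Lemma rmorph_bf (R S : comNzRingType) (f : {rmorphism R -> S}) n c u v :
  f (@bf R n c u v) = bf (f \o c) (f \o u) (f \o v).
Proof. by rewrite rmorph_sum; apply: eq_bigr => i _; rewrite !rmorphM. Qed.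

Section CasselsPfister.
Variables (F : fieldType) (n : nat) (c : 'I_n -> F).
Hypothesis anis_c : anisotropic c.
Implicit Types (P Q : 'I_n -> {poly F}) (d g : {poly F}).
Let C := polyC \o c.

Lemma size_qf P m : (forall i, size (P i) <= m.+1)%N ->
  (size (qf C P) <= m.*2.+1)%N.
Proof.
move=> sP; apply: (leq_trans (size_sum _ _ _)); apply/bigmax_leqP => i _.
rewrite /C /= mul_polyC; apply: leq_trans (size_scale_leq _ _) _.
apply: leq_trans (size_poly_exp_leq _ _) _; rewrite ltnS -muln2 leq_mul2r /=.
by have := sP i; case: (size _).
Qed.

Lemma coef_qf P m : (forall i, size (P i) <= m.+1)%N ->
  (qf C P)`_m.*2 = qf c (fun i => (P i)`_m).
Proof.
move=> sP; rewrite coef_sum; apply: eq_bigr => i _.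
rewrite /C /= coefCM expr2 coefM; congr (_ * _).
rewrite -addnn (bigD1 (inord m)) //= inordK ?ltnS ?leq_addr // addnK.
rewrite big1 ?addr0 // => j; rewrite -val_eqE /= inordK ?ltnS ?leq_addr // => nj.
have [lt_jm|lt_mj|eq] := ltngtP j m; last by rewrite eq eqxx in nj.
  rewrite [X in _ * X]nth_default ?mulr0 //.
  by apply: leq_trans (sP i) _; rewrite ltn_subRL addnC ltn_add2l.
by rewrite [X in X * _]nth_default ?mul0r //; apply: leq_trans (sP i) _.
Qed.

(** The leading coefficients of an anisotropic form cannot cancel, so the degree
    of a value is exactly twice the largest degree of the arguments.  All degree
    bounds below come from this. *)
Lemma anisotropic_size P m : (size (qf C P) <= m.*2)%N ->
  forall i, (size (P i) <= m)%N.
Proof.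
move=> sq; suff H k : (forall i, size (P i) <= m + k)%N ->
    forall i, (size (P i) <= m)%N.
  pose M := \max_i size (P i); apply: (H M) => i.
  by apply: leq_trans (leq_addl _ _); apply: (leq_bigmax i).
elim: k => [|k IHk] sP; first by rewrite addn0 in sP.
apply: IHk => i; rewrite addnS in sP.
have /anis_c/(_ i) Pi0 : qf c (fun i => (P i)`_(m + k)) = 0.
  by rewrite -coef_qf // nth_default // (leq_trans sq) // leq_double leq_addr.
apply/leq_sizeP => j; rewrite leq_eqVlt => /predU1P[<- //|ltj].
by rewrite nth_default // (leq_trans (sP i)).
Qed.

Lemma anisotropic_poly : anisotropic C.
Proof.
move=> P qP0 i; apply/eqP; rewrite -size_poly_eq0 -leqn0.
by apply: anisotropic_size; rewrite qP0 size_poly0.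
Qed.

(** A polynomial represented over F(x) is represented over F[x].  Write P as
    d U + R by division.  The line through P / d and U meets the quadric
    qf C = g in a second point, and its denominator is qf C R / d, of smaller
    degree than d.  The second point lies in the span of P and U, which is why
    a linear relation with constant coefficients survives. *)
Theorem cassels_pfister (l : 'I_n -> F) g P d :
    d != 0 -> qf C P = g * d ^+ 2 -> \sum_i l i *: P i = 0 ->
  exists2 Q, qf C Q = g & \sum_i l i *: Q i = 0.
Proof.
have [m] := ubnP (size d); elim: m => // m IHm in P d *.
rewrite ltnS => sdm dN0 qP lP.
pose U i := P i %/ d; pose R i := P i %% d.
have PE i : P i = d * U i + R i by rewrite mulrC -divp_eq.
have lU : \sum_i l i *: U i = 0.
  transitivity ((\sum_i l i *: P i) %/ d); last by rewrite lP div0p.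
  apply/esym; apply: (big_ind2 (fun p q => p %/ d = q)); first exact: div0p.
    by move=> p q p' q' <- <-; rewrite divpD.
  by move=> i _; rewrite divpZl.
(* A P + B U over A d + B is the second intersection point. *)
pose A := qf C U - g; pose B := (g * d - bf C P U) *+ 2.
have qR : (A * d + B) * d = qf C R.
  have -> : qf C R = qf C (fun i => 1 * P i + (- d) * U i).
    by apply: eq_qf => i; rewrite [in RHS]PE; ring.
  by rewrite qfD qP /A /B; ring.
have [R0|RN0] := eqVneq (qf C R) 0.
  have {}R0 := anisotropic_poly R0.
  exists U => //; apply: (mulIf (expf_neq0 2 dN0)); rewrite -qP.
  rewrite /qf mulr_suml; apply: eq_bigr => i _; rewrite PE R0; ring.
have sR i : (size (R i) < size d)%N by rewrite ltn_modp.
have d'N0 : A * d + B != 0 by apply: contraNneq RN0 => e; rewrite -qR e mul0r.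
apply: (IHm (fun i => A * P i + B * U i) (A * d + B)) => //.
- have sd2 : (size d = (size d).-2.+2)%N.
    suff : (1 < size d)%N by move: (size d); lia.
    rewrite ltnNge; apply: contraNN RN0 => sd1; rewrite /qf big1 // => i _.
    have /eqP : size (R i) = 0%N.
      by have := sR i; move: sd1; move: (size d); lia.
    by rewrite size_poly_eq0 => /eqP ->; rewrite expr0n mulr0.
  have := @size_qf R (size d).-2 _; rewrite -qR size_mul // => H.
  have {}H : ((size (A * d + B)%R + size d).-1 <= (size d).-2.*2.+1)%N.
    by apply: H => j; have := sR j; move: sd2; move: (size d) (size (R j)); lia.
  apply: leq_trans sdm; move: H sd2.
  by move: (size d) (size (A * d + B)%R); lia.
- rewrite qfD qP /A /B; ring.
transitivity (A * (\sum_i l i *: P i) + B * (\sum_i l i *: U i)).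
  rewrite !mulr_sumr -big_split; apply: eq_bigr => i _ /=.
  by rewrite scalerDr !scalerAr.
by rewrite lP lU !mulr0 addr0.
Qed.

End CasselsPfister.

(** * Reflections, rational functions, and the function field of a quadric *)

Lemma eq_anisotropic (R : comNzRingType) n (c c' : 'I_n -> R) :
  c =1 c' -> anisotropic c -> anisotropic c'.
Proof.
move=> e ac v qv; apply: ac; rewrite -qv.
by apply: eq_bigr => i _; rewrite e.
Qed.

(** The reflection in u - w is an isometry that carries u to w, hence the
    orthogonal complement of u into that of w. *)
Lemma reflection (E : fieldType) n (c u v w : 'I_n -> E) :
    anisotropic c -> qf c u = qf c w -> bf c v u = 0 ->
  exists2 v', qf c v' = qf c v & bf c v' w = 0.
Proof.
move=> ac quw vu0; pose r i := 1 * u i + (-1) * w i.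
have [r0|rN0] := eqVneq (qf c r) 0.
  exists v => //; rewrite -vu0; apply: eq_bigr => i _; congr (_ * (_ * _)).
  apply/esym/eqP; rewrite -subr_eq0.
  by have := ac _ r0 i; rewrite /r mul1r mulN1r => ->.
have qr : qf c r = bf c r w *- 2.
  by rewrite bfDl qfD quw bfE; ring.
have vr : bf c v r = - bf c v w by rewrite bfC bfDl bfC vu0 bfC; ring.
exists (fun i => 1 * v i + (- (bf c v r *+ 2 / qf c r)) * r i).
  by rewrite qfD; field.
rewrite bfDl vr qr; rewrite qr in rN0; field.
apply: contraNneq rN0 => e.
by rewrite -mulNrn mulNrn -mulr_natl mulrC e ?mul0r ?oppr0.
Qed.

(** The discriminant of a diagonal form does not depend, up to squares, on the
    orthogonal basis that computes it. *)
Lemma discriminant_square (F : fieldType) n (c : 'I_n -> F)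
    (v : 'I_n -> 'I_n -> F) :
    (forall i j, i != j -> bf c (v i) (v j) = 0) ->
  exists t, \prod_i qf c (v i) = (\prod_i c i) * t ^+ 2.
Proof.
move=> ov; pose M := \matrix_(i, j) v i j.
exists (\det M).
have -> : \prod_i qf c (v i) = \det (diag_mx (\row_i qf c (v i))).
  by rewrite det_diag; apply: eq_bigr => i _; rewrite mxE.
have -> : \prod_i c i = \det (diag_mx (\row_i c i)).
  by rewrite det_diag; apply: eq_bigr => i _; rewrite mxE.
rewrite mulrC expr2 -mulrA [\det M * \det (diag_mx _)]mulrC.
rewrite -{2}(det_tr M) [\det (diag_mx (\row_i c i)) * _]mulrC.
rewrite [\det M^T * _]mulrC -!det_mulmx; congr (\det _).
apply/matrixP => i j; rewrite !mxE.
have -> : \sum_k M i k * (diag_mx (\row_i0 c i0) *m M^T) k j = bf c (v i) (v j).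
  apply: eq_bigr => k _; rewrite mul_diag_mx !mxE; ring.
have [->|nij] := eqVneq i j; first by rewrite bfE mulr1n.
by rewrite ov.
Qed.


Local Notation "x %:F" := (FracField.tofrac x).

Lemma fraction_num_den (R : idomainType) (x : {fraction R}) :
  exists2 d : R, d != 0 & exists n, x * d%:F = n%:F.
Proof.
elim/quotW: x => x; exists x.2; first exact: denom_ratioP.
exists x.1; rewrite !piE.
change (\pi_({fraction R})%qT (FracField.mulf x (Ratio x.2 1))
        = \pi_({fraction R})%qT (Ratio x.1 1)).
apply/eqmodP; rewrite /= FracField.equivfE /FracField.mulf.
by rewrite !numden_Ratio ?mulr1 ?oner_eq0 ?denom_ratioP // mulrC.
Qed.

(** Clearing denominators lets the polynomial form of the Cassels-Pfister theorem
    be applied to vectors of rational functions. *)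
Lemma common_denominator (R : idomainType) n (v : 'I_n -> {fraction R}) :
  exists d (N : 'I_n -> R), d != 0 /\ forall i, v i * d%:F = (N i)%:F.
Proof.
have /fin_all_exists[d /fin_all_exists[N dN]] i :
    exists d N, d != 0 /\ v i * d%:F = N%:F.
  by have [d dN0 [N NE]] := fraction_num_den (v i); exists d, N.
exists (\prod_i d i), (fun i => N i * \prod_(j | j != i) d j); split.
  by apply/prodf_neq0 => i _; have [] := dN i.
move=> i; rewrite (bigD1 i) //= !rmorphM /= mulrA.
by have [_ ->] := dN i.
Qed.

Section RationalFunctions.

Variable F : fieldType.

Definition to_ratfun : {rmorphism F -> {fraction {poly F}}} :=
  (@FracField.tofrac {poly F} : {rmorphism _ -> _})
    \o (polyC : {rmorphism _ -> _}).

Variables (n : nat) (c : 'I_n -> F).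
Hypothesis anis_c : anisotropic c.

Lemma anisotropic_ratfun : anisotropic (to_ratfun \o c).
Proof.
move=> v qv0; have [d [N [dN0 vd]]] := common_denominator v.
have qN : qf (polyC \o c) N = 0.
  apply/eqP; rewrite -tofrac_eq0 rmorph_qf; apply/eqP.
  rewrite (eq_qf _ (v' := fun i => v i * d%:F)) => [|i]; last by rewrite /= vd.
  by rewrite qfZ qv0 mul0r.
move=> i; apply/eqP; have := vd i; rewrite (anisotropic_poly anis_c qN) rmorph0.
by move/eqP; rewrite mulf_eq0 tofrac_eq0 (negPf dN0) orbF.
Qed.

Lemma cassels_pfister_ratfun (l : 'I_n -> F) g v :
    qf (to_ratfun \o c) v = g%:F -> \sum_i to_ratfun (l i) * v i = 0 ->
  exists2 Q, qf (polyC \o c) Q = g & \sum_i l i *: Q i = 0.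
Proof.
move=> qv lv; have [d [N [dN0 vd]]] := common_denominator v.
apply: (cassels_pfister (P := N) anis_c dN0); apply/eqP; rewrite -tofrac_eq.
  rewrite rmorph_qf (eq_qf _ (v' := fun i => v i * d%:F)) => [|i].
    by rewrite qfZ qv rmorphM rmorphXn.
  by rewrite /= vd.
apply/eqP; rewrite rmorph0 rmorph_sum /=.
transitivity ((\sum_i to_ratfun (l i) * v i) * d%:F); last by rewrite lv mul0r.
rewrite mulr_suml; apply: eq_bigr => i _.
by rewrite -mul_polyC rmorphM /= -vd mulrA.
Qed.

Hypothesis two_neq0 : (2%:R : F) != 0.

(** A polynomial solution for a value of degree 2 is linear; its two coefficient
    vectors are orthogonal because the value has no term of degree 1. *)
Lemma linear_solution (Q : 'I_n -> {poly F}) al be :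
    qf (polyC \o c) Q = al *: 'X^2 + be%:P ->
  exists u v : 'I_n -> F, [/\ forall i, Q i = (u i)%:P + v i *: 'X,
    qf c u = be, qf c v = al & bf c u v = 0].
Proof.
move=> qQ; pose u i := (Q i)`_0; pose v i := (Q i)`_1.
have sQ : forall i, (size (Q i) <= 2)%N.
  apply: (anisotropic_size anis_c); rewrite qQ.
  apply: leq_trans (size_polyD _ _) _; rewrite geq_max.
  rewrite (leq_trans (size_scale_leq _ _)) ?size_polyXn //.
  exact: leq_trans (size_polyC_leq1 _) _.
have QE i : Q i = (u i)%:P + v i *: 'X.
  apply/polyP => k; rewrite coefD coefC coefZ coefX.
  case: k => [|[|k]]; rewrite /= ?mulr0 ?mulr1 ?addr0 ?add0r //.
  by rewrite nth_default // (leq_trans (sQ i)).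
have : qf (polyC \o c) Q
    = qf (polyC \o c) (fun i => 1 * (polyC \o u) i + 'X * (polyC \o v) i).
  by apply: eq_qf => i; rewrite QE /= mul1r -mul_polyC mulrC.
rewrite qfD qQ -!rmorph_qf -rmorph_bf expr1n !mul1r /= => e.
have ek k := congr1 (coefp k) e.
move: (ek 0%N) (ek 1%N) (ek 2%N); rewrite /= !coefE /= => e0 e1 e2.
exists u, v; split=> //; [ring: e0 | ring: e2 |].
apply: (mulfI two_neq0); apply: etrans (etrans (esym e1) _); ring.
Qed.

End RationalFunctions.

Section Quaternions.
Variable R : comNzRingType.
Implicit Types d e : R.

Definition norm_form d e (i : 'I_4) := nth 0 [:: 1; - d; - e; d * e] i.
Definition pure_form d e (i : 'I_3) := nth 0 [:: d; e; - (d * e)] i.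
Definition vec3 (x y z : R) (i : 'I_3) := nth 0 [:: x; y; z] i.
Definition vec4 (w x y z : R) (i : 'I_4) := nth 0 [:: w; x; y; z] i.

(** For d, e in a field, anisotropy of the norm form of (d, e) means that
    (d, e) is a division algebra. *)
Definition nonsplit d e := anisotropic (norm_form d e).

Lemma qf_norm_form d e w x y z : qf (norm_form d e) (vec4 w x y z) =
  w ^+ 2 - d * x ^+ 2 - e * y ^+ 2 + d * e * z ^+ 2.
Proof. rewrite /qf !big_ord_recl big_ord0 /norm_form /vec4 /=; ring. Qed.

Lemma qf_pure_form d e x y z : qf (pure_form d e) (vec3 x y z) =
  d * x ^+ 2 + e * y ^+ 2 - d * e * z ^+ 2.
Proof. rewrite /qf !big_ord_recl big_ord0 /pure_form /vec3 /=; ring. Qed.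

Lemma vec3E (v : 'I_3 -> R) : v =1 vec3 (v 0) (v 1) (v 2%:R).
Proof. by case=> [[|[|[|//]]]] ?; rewrite /vec3 /=; congr v; apply: val_inj. Qed.

Lemma vec4E (v : 'I_4 -> R) : v =1 vec4 (v 0) (v 1) (v 2%:R) (v 3%:R).
Proof. by case=> [[|[|[|[|//]]]]] ?; rewrite /vec4 /=; congr v; apply: val_inj. Qed.

Lemma nonsplitP d e : (forall w x y z,
    w ^+ 2 - d * x ^+ 2 - e * y ^+ 2 + d * e * z ^+ 2 = 0 ->
    [/\ w = 0, x = 0, y = 0 & z = 0]) <-> nonsplit d e.
Proof.
split=> [an v qv i | an w x y z]; last first.
  rewrite -qf_norm_form => /an v0.
  by split; [have := v0 0 | have := v0 1 | have := v0 2%:R | have := v0 3%:R].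
rewrite vec4E; move: qv; rewrite (eq_qf _ (vec4E v)) qf_norm_form => /an[].
by rewrite /vec4; case: i => [[|[|[|[|//]]]]] ? /=.
Qed.

Lemma anisotropic_pure_form d e : nonsplit d e -> anisotropic (pure_form d e).
Proof.
move=> /nonsplitP an v qv i.
move: qv; rewrite (eq_qf _ (vec3E v)) qf_pure_form (vec3E v i) => e0.
have [|_] := an 0 (v 0) (v 1) (v 2%:R).
  by rewrite expr0n sub0r -[RHS]oppr0 -e0; ring.
by rewrite /vec3; case: i => [[|[|[|//]]]] ? /=.
Qed.

End Quaternions.

Lemma rmorph_norm_form (R S : comNzRingType) (f : {rmorphism R -> S}) d e :
  f \o norm_form d e =1 norm_form (f d) (f e).
Proof.
by case=> [[|[|[|[|//]]]]] ? /=;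
   rewrite /norm_form /= ?rmorph1 ?rmorphN ?rmorphM.
Qed.

Lemma rmorph_pure_form (R S : comNzRingType) (f : {rmorphism R -> S}) d e :
  f \o pure_form d e =1 pure_form (f d) (f e).
Proof. by case=> [[|[|[|//]]]] ? /=; rewrite /pure_form /= ?rmorphN ?rmorphM. Qed.

Lemma nonsplit_ratfun (F : fieldType) (d e : F) :
  nonsplit d e -> nonsplit (to_ratfun F d) (to_ratfun F e).
Proof.
move=> /anisotropic_ratfun; apply: eq_anisotropic; exact: rmorph_norm_form.
Qed.

(** A zero p + q w of the norm form N, with w outside E, satisfies
    N(p) + g N(q) = 0 and has p orthogonal to q.  Then p times the conjugate of
    q is a pure quaternion, and dividing it by N(q) gives one of square g. *)
Lemma nonsplit_sqrt_ext (E L : fieldType) (f : {rmorphism E -> L}) (w : L)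
    (g d e : E) :
    (2%:R : E) != 0 -> w ^+ 2 = f g ->
    (forall u, exists p q, u = f p + f q * w) ->
    nonsplit d e -> (forall v, qf (pure_form d e) v != g) ->
  nonsplit (f d) (f e).
Proof.
move=> two_neq0 w2 gen /nonsplitP ns npure; apply/nonsplitP => x0 x1 x2 x3.
have [p0 [q0 ->]] := gen x0; have [p1 [q1 ->]] := gen x1.
have [p2 [q2 ->]] := gen x2; have [p3 [q3 ->]] := gen x3.
pose N (a b c k : E) := a ^+ 2 - d * b ^+ 2 - e * c ^+ 2 + d * e * k ^+ 2.
pose B := p0 * q0 - d * p1 * q1 - e * p2 * q2 + d * e * p3 * q3.
have NN : (f p0 + f q0 * w) ^+ 2 - f d * (f p1 + f q1 * w) ^+ 2
   - f e * (f p2 + f q2 * w) ^+ 2 + f d * f e * (f p3 + f q3 * w) ^+ 2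
   = f (N p0 p1 p2 p3 + g * N q0 q1 q2 q3) + f (B *+ 2) * w.
  rewrite /N /B; rewrite !(rmorphD, rmorphB, rmorphM, rmorphXn, rmorphMn) /=.
  ring: w2.
rewrite NN => NN0.
have [B0|] := eqVneq B 0; last first.
  rewrite -(mulrI_eq0 _ (mulfI two_neq0)) mulr_natl => BN0.
  have [s ws] : exists s, w = f s.
    exists (- (N p0 p1 p2 p3 + g * N q0 q1 q2 q3) / (B *+ 2)).
    apply: (mulIf (_ : f (B *+ 2) != 0)); first by rewrite fmorph_eq0.
    rewrite -[RHS]rmorphM divfK // rmorphN mulrC; apply/eqP.
    by rewrite -addr_eq0 addrC NN0.
  have g2 : s ^+ 2 = g by apply: (fmorph_inj f); rewrite -w2 ws rmorphXn.
  have : f (N (p0 + q0 * s) (p1 + q1 * s) (p2 + q2 * s) (p3 + q3 * s)) = 0.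
    rewrite -NN0 ws -rmorphM -rmorphD; congr (f _); rewrite /N /B -g2; ring.
  move/eqP; rewrite fmorph_eq0 => /eqP/ns[z0 z1 z2 z3].
  by rewrite ws -!rmorphM -!rmorphD z0 z1 z2 z3 rmorph0.
move: NN0; rewrite B0 mul0rn rmorph0 mul0r addr0 => /eqP.
rewrite fmorph_eq0 => /eqP Npq.
have [Nq|NqN0] := eqVneq (N q0 q1 q2 q3) 0.
  have [z0 z1 z2 z3] := ns _ _ _ _ Nq; move: Npq.
  rewrite Nq mulr0 addr0 => /ns[-> -> -> ->].
  by rewrite z0 z1 z2 z3 rmorph0 mul0r addr0.
pose M := N q0 q1 q2 q3.
(* The pure part of p times the conjugate of q, divided by the norm of q. *)
case/eqP: (npure (vec3 ((p1 * q0 - p0 * q1 + e * (p2 * q3 - p3 * q2)) / M)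
               ((p2 * q0 - p0 * q2 + d * (p3 * q1 - p1 * q3)) / M)
               ((p3 * q0 - p0 * q3 + p2 * q1 - p1 * q2) / M))).
rewrite qf_pure_form; apply: (mulIf (expf_neq0 2 NqN0)).
rewrite -/M !expr_div_n.
have -> : forall x y z, (d * (x / M ^+ 2) + e * (y / M ^+ 2)
    - d * e * (z / M ^+ 2)) * M ^+ 2 = d * x + e * y - d * e * z.
  by move=> x y z; field.
have -> : g * M ^+ 2
    = - (N p0 p1 p2 p3) * M + (N p0 p1 p2 p3 + g * M) * M by ring.
rewrite Npq mul0r addr0.
transitivity (- N p0 p1 p2 p3 * M + B * B); first by rewrite /M /N /B; ring.
by rewrite B0 mulr0 addr0.
Qed.

Section SlotExtension.
Variable K : fieldType.
Hypothesis two_neq0 : (2%:R : K) != 0.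
Variables a b c : K.
Hypotheses (aN0 : a != 0) (bN0 : b != 0).
Hypothesis c_nonsquare : forall s, s ^+ 2 != c.

Let Kx := {fraction {poly K}}.
Let Kxy := {fraction {poly Kx}}.

Definition slot_rhs : {poly K} := b^-1 *: (c%:P - a *: 'X^2).

(** The element g = a y^2 + (c - a x^2) / b: adjoining its square root w gives
    c = a x^2 + b w^2 - a b y^2. *)
Definition slot_poly : {poly Kx} :=
  to_ratfun K a *: 'X^2 + (slot_rhs%:F)%:P.

(** If the pure form of (d, e) represented g, successive applications of the
    Cassels-Pfister theorem would produce an orthogonal basis over K on which
    this form takes the values a, c / b and - a / b.  Its discriminant being - 1
    up to squares, c would be a square. *)
Lemma slot_not_represented (d e : K) (u : 'I_3 -> Kxy) : nonsplit d e ->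
  let D := to_ratfun Kx (to_ratfun K d) in
  let E := to_ratfun Kx (to_ratfun K e) in
  qf (pure_form D E) u <> slot_poly%:F.
Proof.
move=> ns D E qu; pose C := pure_form d e.
have aC : anisotropic C by apply: anisotropic_pure_form.
have aCx : anisotropic (to_ratfun K \o C) by apply: anisotropic_ratfun.
have two' : (2%:R : Kx) != 0 by rewrite -(rmorph_nat (to_ratfun K)) fmorph_eq0.
have [Q qQ _] : exists2 Q, qf (polyC \o (to_ratfun K \o C)) Q = slot_poly
    & \sum_i (fun=> 0) i *: Q i = 0.
  apply: (cassels_pfister_ratfun aCx (v := u)).
    rewrite -qu /D /E; apply: eq_bigr => i _; congr (_ * _).
    rewrite -(rmorph_pure_form (to_ratfun Kx)) /=.
    by rewrite -(rmorph_pure_form (to_ratfun K)).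
  by rewrite big1 // => i _; rewrite rmorph0 mul0r.
have [v0 [v1 [_ qv0 qv1 v01]]] := linear_solution aCx two' qQ.
(* The value a is constant, so it is already attained by a vector w over K. *)
have [W qW _] : exists2 W, qf (polyC \o C) W = a%:P
    & \sum_i (fun=> 0) i *: W i = 0.
  apply: (cassels_pfister_ratfun aC qv1).
  by rewrite big1 // => i _; rewrite rmorph0 mul0r.
have WC i : W i = ((W i)`_0)%:P.
  apply: size1_polyC; apply: (anisotropic_size aC (m := 1)); rewrite qW.
  by apply: leq_trans (size_polyC_leq1 _) _.
pose w i := (W i)`_0.
have qw : qf C w = a.
  apply: (@polyC_inj K); rewrite -qW rmorph_qf.
  by apply: eq_qf => i; rewrite WC.
have [v0' qv0' v0'w] : exists2 v',
      qf (to_ratfun K \o C) v' = qf (to_ratfun K \o C) v0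
    & bf (to_ratfun K \o C) v' (to_ratfun K \o w) = 0.
  by apply: reflection aCx _ v01; rewrite -rmorph_qf qw qv1.
(* The relation kept here is orthogonality to w. *)
have [S qS wS] : exists2 S, qf (polyC \o C) S = slot_rhs
    & \sum_i (C i * w i) *: S i = 0.
  apply: (cassels_pfister_ratfun aC (v := v0')); first by rewrite qv0' qv0.
  apply: etrans v0'w; apply: eq_bigr => i _ /=.
  by rewrite !rmorphM /=; ring.
have [s0 [s1 [SE qs0 qs1 s01]]] : exists u v : 'I_3 -> K,
   [/\ forall i, S i = (u i)%:P + v i *: 'X,
    qf C u = c / b, qf C v = - (a / b) & bf C u v = 0].
  apply: linear_solution => //; rewrite qS /slot_rhs.
  by rewrite -!mul_polyC rmorphN !rmorphM /=; ring.
have ws k : \sum_i C i * w i * (S i)`_k = 0.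
  have := congr1 (coefp k) wS; rewrite /= coef0 coef_sum; apply: etrans.
  by apply: eq_bigr => i _; rewrite coefZ.
have ws0 : bf C w s0 = 0.
  apply: etrans (ws 0%N); apply: eq_bigr => i _.
  by rewrite SE !coefE /= mulr0 addr0 mulrA.
have ws1 : bf C w s1 = 0.
  apply: etrans (ws 1%N); apply: eq_bigr => i _.
  by rewrite SE !coefE /= mulr1 add0r mulrA.
pose V (i : 'I_3) := nth w [:: w; s0; s1] i.
have [|t] := @discriminant_square K 3 C V.
  by case=> [[|[|[|//]]]] ? [[|[|[|//]]]] ?; rewrite /V //= bfC.
rewrite !big_ord_recl !big_ord0 /= /V /C /pure_form /= -/C qw qs0 qs1 => e0.
have /eqP := c_nonsquare (d * e * t * b / a); apply.
apply: (mulIf (_ : - (a ^+ 2 / b ^+ 2) != 0)).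
  by rewrite oppr_eq0 mulf_neq0 ?invr_eq0 ?expf_neq0.
transitivity (a * (c / b * (- (a / b) * 1))); last by field.
by rewrite e0; field; rewrite aN0 bN0.
Qed.

Variables (L : fieldType) (f : {rmorphism Kxy -> L}) (w : L).
Hypothesis w2 : w ^+ 2 = f slot_poly%:F.

Let to_L : {rmorphism K -> L} := f \o (to_ratfun Kx \o to_ratfun K).

Lemma slot_represented :
  exists v, qf (pure_form (to_L a) (to_L b)) v = to_L c.
Proof.
exists (vec3 (f (to_ratfun Kx ('X%:F))) w (f ('X%:F))).
rewrite qf_pure_form w2.
pose h : {rmorphism Kx -> L} := f \o to_ratfun Kx.
have Hx : h (b%:P%:F * slot_rhs%:F) = h (c%:P%:F - a%:P%:F * 'X%:F ^+ 2).
  congr (h _); rewrite /slot_rhs -!mul_polyC -tofracM mulrA -polyCM mulfV //.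
  rewrite mul1r.
  by rewrite tofracB tofracM tofracXn.
rewrite (rmorphM h) (rmorphB h) (rmorphM h) (rmorphXn h) in Hx.
have Hy : f slot_poly%:F = f (to_ratfun Kx (to_ratfun K a) * 'X%:F ^+ 2
                              + to_ratfun Kx (slot_rhs%:F)).
  by congr (f _); rewrite /slot_poly -!mul_polyC tofracD tofracM tofracXn.
rewrite (rmorphD f) (rmorphM f) (rmorphXn f) in Hy.
suff id (A B C S X Y : L) : B * S = C - A * X ^+ 2 ->
    A * X ^+ 2 + B * (A * Y ^+ 2 + S) - A * B * Y ^+ 2 = C.
  by rewrite Hy; exact: id Hx.
by move=> BS; rewrite mulrDr BS; ring.
Qed.

Lemma nonsplit_slot_extension (d e : K) :
    (forall u, exists p q, u = f p + f q * w) ->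
  nonsplit d e -> nonsplit (to_L d) (to_L e).
Proof.
move=> gen nsde; apply: (nonsplit_sqrt_ext _ w2 gen) => [||v].
- by rewrite -(rmorph_nat (to_ratfun Kx \o to_ratfun K)) fmorph_eq0.
- exact/nonsplit_ratfun/nonsplit_ratfun.
- exact/eqP/slot_not_represented.
Qed.

End SlotExtension.

(** * One extension step between countable fields *)

(** Countability is kept as a mere proposition: it has to pass through fraction
    fields and quadratic extensions without disturbing their ring structures. *)
Definition enumerable (T : Type) :=
  exists e : nat -> T, forall x, exists n, e n = x.

Lemma enumerable_image (A B : Type) (f : A -> B) :
  (forall y, exists x, f x = y) -> enumerable A -> enumerable B.
Proof.
move=> sf [e se]; exists (f \o e) => y.
by have [x <-] := sf y; have [n <-] := se x; exists n.
Qed.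

Lemma enumerable_count (T : countType) : T -> enumerable T.
Proof.
move=> x0; exists (fun n => odflt x0 (unpickle n)) => x.
by exists (pickle x); rewrite pickleK.
Qed.

Lemma enumerable_pair (A B : Type) :
  enumerable A -> enumerable B -> enumerable (A * B).
Proof.
move=> [e se] [e' se'].
apply: (@enumerable_image (nat * nat)%type _ (fun p => (e p.1, e' p.2))).
  by move=> [x y]; have [m <-] := se x; have [n <-] := se' y; exists (m, n).
exact: enumerable_count (0, 0)%N.
Qed.

Lemma enumerable_poly (R : nzRingType) : enumerable R -> enumerable {poly R}.
Proof.
move=> [e se]; apply: (@enumerable_image (seq nat) _ (fun s => Poly (map e s))).
  move=> p; suff [s sE] : exists s, map e s = p by exists s; rewrite sE polyseqK.
  elim: (polyseq p) => [|x q [s <-]]; first by exists [::].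
  by have [n <-] := se x; exists (n :: s).
exact: enumerable_count [::].
Qed.

Lemma enumerable_fraction (R : idomainType) :
  enumerable R -> enumerable {fraction R}.
Proof.
move=> eR; apply: (enumerable_image (A := R * R)
  (f := fun p => FracField.tofrac p.1 / FracField.tofrac p.2)).
move=> x; have [d dN0 [n xd]] := fraction_num_den x; exists (n, d) => /=.
  by rewrite -xd mulfK // tofrac_eq0.
exact: enumerable_pair.
Qed.

Lemma horner_quadratic (E L : fieldType) (f : {rmorphism E -> L}) (w : L)
    (g : E) (q : {poly E}) :
  w ^+ 2 = f g -> exists p p', (map_poly f q).[w] = f p + f p' * w.
Proof.
move=> w2; elim/poly_ind: q => [|q k [p' [q' IHq]]].
  by exists 0, 0; rewrite !rmorph0 horner0 mul0r addr0.
exists (q' * g + k), p'; rewrite rmorphD rmorphM /= map_polyX map_polyC /=.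
by rewrite hornerMXaddC IHq rmorphD rmorphM /= -w2; ring.
Qed.

Lemma sqrt_extension (E : fieldType) (g : E) :
  exists (L : fieldType) (f : {rmorphism E -> L}) (w : L),
    w ^+ 2 = f g /\ forall u, exists p q, u = f p + f q * w.
Proof.
have [[s sg]|ns] := EM (exists s, s ^+ 2 = g).
  by exists E, idfun, s; split=> // u; exists u, 0; rewrite rmorph0 mul0r addr0.
pose p := 'X^2 - g%:P.
have [|L dimL [w rw gen]] := @irredp_FAdjoin E p.
  apply: cubic_irreducible; first by rewrite size_XnsubC.
  move=> x; apply/negP; rewrite /root !hornerE subr_eq0 => /eqP xg.
  by apply: ns; exists x.
have {rw}w2 : w ^+ 2 = in_alg L g.
  apply/eqP; rewrite -subr_eq0; move: rw.
  by rewrite /root rmorphB /= map_polyXn map_polyC !hornerE.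
exists L, (in_alg L), w; split=> // u.
have : u \in <<1; w>>%VS by rewrite gen memvf.
case/Fadjoin_polyP => _ /polyOver1P[q ->] ->.
exact: (horner_quadratic q w2).
Qed.


(** L is the function field of the quadric a X^2 + b Y^2 - a b Z^2 = c, which is
    countable since it is generated by one square root over K(x)(y). *)
Lemma slot_extension (K : fieldType) (a b c : K) : enumerable K ->
    (2%:R : K) != 0 -> a != 0 -> b != 0 -> (forall s, s ^+ 2 != c) ->
  exists (L : fieldType) (f : {rmorphism K -> L}), [/\ enumerable L,
    forall d e, nonsplit d e -> nonsplit (f d) (f e)
    & exists v, qf (pure_form (f a) (f b)) v = f c].
Proof.
move=> enK two_neq0 aN0 bN0 cns.
pose Kxy := {fraction {poly {fraction {poly K}}}}.
have [L [f [w [w2 gen]]]] := sqrt_extension ((slot_poly a b c)%:F).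
exists L, (f \o (to_ratfun {fraction {poly K}} \o to_ratfun K)
            : {rmorphism _ -> _}).
split=> [|d e|]; last exact: slot_represented w2.
  have enKxy : enumerable Kxy by do 2!apply/enumerable_fraction/enumerable_poly.
  apply: (enumerable_image (A := Kxy * Kxy) (f := fun p => f p.1 + f p.2 * w)).
    by move=> u; have [p [q ->]] := gen u; exists (p, q).
  exact: enumerable_pair.
exact: (nonsplit_slot_extension two_neq0 aN0 bN0 cns w2 gen).
Qed.

(** * Direct limits of fields and the slot closure *)

Section DirectLimit.
Variables (F : nat -> fieldType) (f : forall n, {rmorphism F n -> F n.+1}).

Definition tower := {n : nat & F n}.
Definition climb (u : tower) : tower := Tagged F (f (tag u) (tagged u)).

Lemma Tagged_inj n (x y : F n) : Tagged F x = Tagged F y -> x = y.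
Proof. exact: Eqdep_dec.inj_pair2_eq_dec _ PeanoNat.Nat.eq_dec _ _ _ _. Qed.

Lemma climb_inj : injective climb.
Proof.
move=> [m x] [n y] e; have [emn] := congr1 tag e.
case: n / emn y e => y e.
by have /fmorph_inj -> := @Tagged_inj m.+1 (f m x) (f m y) e.
Qed.

Lemma tag_climb k u : tag (iter k climb u) = (k + tag u)%N.
Proof. by elim: k => //= k ->. Qed.

(** Identifying two elements of the tower when some iterates of [climb] agree
    avoids transporting elements along equalities between indices. *)
Definition same_limit (u v : tower) : bool :=
  `[< exists k l, iter k climb u = iter l climb v >].

Lemma same_limit_refl : reflexive same_limit.
Proof. by move=> u; apply/asboolP; exists 0%N, 0%N. Qed.

Lemma same_limit_sym : symmetric same_limit.
Proof. by move=> u v; apply/asboolP/asboolP => -[k [l e]]; exists l, k. Qed.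

Lemma same_limit_trans : transitive same_limit.
Proof.
move=> v u w /asboolP[k [l e]] /asboolP[k' [l' e']].
apply/asboolP; exists (k' + k)%N, (l + l')%N.
by rewrite !iterD e -e' -!iterD addnC.
Qed.

Canonical same_limit_equiv :=
  EquivRel same_limit same_limit_refl same_limit_sym same_limit_trans.

Definition limit : Type := {eq_quot same_limit}%qT.
HB.instance Definition _ := Choice.on limit.

Definition into n (x : F n) : limit :=
  \pi_({eq_quot same_limit})%qT (Tagged F x).

Lemma into_climb n (x : F n) : into (f n x) = into x.
Proof. by apply/eqmodP/asboolP; exists 0%N, 1%N. Qed.

Lemma into_inj n : injective (@into n).
Proof.
move=> x y /eqmodP/asboolP[k [l e]]; have := congr1 tag e.
rewrite !tag_climb => /addIn ekl; rewrite {}ekl in e.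
by apply: Tagged_inj; elim: l e => //= l IHl /climb_inj.
Qed.

Lemma into_surj (z : limit) : exists n (x : F n), z = into x.
Proof. by elim/quotW: z => -[n x]; exists n, x. Qed.

Definition compatible (o : forall n, F n -> F n -> F n) :=
  forall n x y, f n (o n x y) = o n.+1 (f n x) (f n y).

(** Elements can be moved to a higher level of the tower compatibly with [into]
    and with an operation; this is what makes the operations of the limit
    independent of the level at which they are computed. *)
Lemma lift_to m n (o : forall n, F n -> F n -> F n) :
    compatible o -> (m <= n)%N ->
  exists g : F m -> F n, (forall x, into (g x) = into x)
     /\ (forall x y, g (o m x y) = o n (g x) (g y)).
Proof.
move=> co; elim: n => [|n IHn].
  by rewrite leqn0 => /eqP ->; exists id.
rewrite leq_eqVlt => /predU1P[->|/IHn[g [ig go]]]; first by exists id.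
exists (f n \o g); split=> [x|x y] /=; first by rewrite into_climb.
by rewrite go co.
Qed.

Lemma into_surj_above N (s : seq limit) :
  exists2 n, (N <= n)%N & forall z, z \in s -> exists x : F n, z = into x.
Proof.
elim: s => [|z s [n len IHs]]; first by exists N.
have [m [x zE]] := into_surj z; exists (maxn m n).
  by rewrite (leq_trans len) ?leq_maxr.
have co : compatible (fun n x y => x) by [].
have [g [ig _]] := lift_to co (leq_maxl m n).
have [h [ih _]] := lift_to co (leq_maxr m n).
move=> y; rewrite inE => /predU1P[->|/IHs[t ->]].
  by exists (g x); rewrite ig.
by exists (h t); rewrite ih.
Qed.

Lemma into2 (z t : limit) : exists p : {n : nat & F n * F n}%type,
  z = into (tagged p).1 /\ t = into (tagged p).2.
Proof.
have [n _ H] := into_surj_above 0 [:: z; t].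
have [|x zE] := H z; first by rewrite mem_head.
have [|y tE] := H t; first by rewrite !inE eqxx orbT.
by exists (Tagged (fun n => F n * F n)%type (x, y)).
Qed.

Definition limit_op (o : forall n, F n -> F n -> F n) (z t : limit) : limit :=
  let p := projT1 (cid (into2 z t)) in
  into (o (tag p) (tagged p).1 (tagged p).2).

Lemma limit_opE o n (x y : F n) : compatible o ->
  limit_op o (into x) (into y) = into (o n x y).
Proof.
move=> co; rewrite /limit_op; case: cid => -[m [x' y']] /= [ex ey].
have [g [ig go]] := lift_to co (leq_maxl m n).
have [h [ih ho]] := lift_to co (leq_maxr m n).
rewrite -ig -ih go ho; congr (into (o _ _ _)); apply: into_inj.
  by rewrite ig ih.
by rewrite ig ih.
Qed.

Let add := limit_op (fun n => +%R).
Let mul := limit_op (fun n => *%R).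
Let opp z := limit_op (fun n x _ => - x) z z.
Let inv z := limit_op (fun n x _ => x^-1) z z.

Lemma limit_addE n (x y : F n) : add (into x) (into y) = into (x + y).
Proof. by apply: limit_opE => k a b; rewrite rmorphD. Qed.

Lemma limit_mulE n (x y : F n) : mul (into x) (into y) = into (x * y).
Proof. by apply: limit_opE => k a b; rewrite rmorphM. Qed.

Lemma limit_oppE n (x : F n) : opp (into x) = into (- x).
Proof. by apply: (@limit_opE (fun n x _ => - x)) => k a b; rewrite rmorphN. Qed.

Lemma limit_invE n (x : F n) : inv (into x) = into x^-1.
Proof.
by apply: (@limit_opE (fun n x _ => x^-1)) => k a b; rewrite fmorphV.
Qed.

Lemma into0 n : into (0 : F n) = into (0 : F 0%N).
Proof. by elim: n => // n <-; rewrite -[in RHS]into_climb rmorph0. Qed.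

Lemma into1 n : into (1 : F n) = into (1 : F 0%N).
Proof. by elim: n => // n <-; rewrite -[in RHS]into_climb rmorph1. Qed.

Lemma into3 (P : limit -> limit -> limit -> Prop) :
  (forall n (x y z : F n), P (into x) (into y) (into z)) ->
  forall x y z, P x y z.
Proof.
move=> H x y z; have [n _ s] := into_surj_above 0 [:: x; y; z].
have [|x' ->] := s x; first by rewrite mem_head.
have [|y' ->] := s y; first by rewrite !inE eqxx orbT.
by have [|z' ->] := s z; first by rewrite !inE eqxx !orbT.
Qed.

Lemma limit_addA : associative add.
Proof. by apply: into3 => n x y z; rewrite !limit_addE addrA. Qed.
Lemma limit_addC : commutative add.
Proof.
move=> x y; apply: (@into3 (fun x y _ => add x y = add y x) _ x y x) => n a b _.
by rewrite !limit_addE addrC.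
Qed.
Lemma limit_add0 : left_id (into (0 : F 0%N)) add.
Proof.
move=> x; have [n [{}x ->]] := into_surj x.
by rewrite -(into0 n) limit_addE add0r.
Qed.
Lemma limit_addN : left_inverse (into (0 : F 0%N)) opp add.
Proof.
move=> x; have [n [{}x ->]] := into_surj x.
by rewrite -(into0 n) limit_oppE limit_addE addNr.
Qed.
HB.instance Definition _ :=
  GRing.isZmodule.Build limit limit_addA limit_addC limit_add0 limit_addN.

Lemma limit_mulA : associative mul.
Proof. by apply: into3 => n x y z; rewrite !limit_mulE mulrA. Qed.
Lemma limit_mulC : commutative mul.
Proof.
move=> x y; apply: (@into3 (fun x y _ => mul x y = mul y x) _ x y x) => n a b _.
by rewrite !limit_mulE mulrC.
Qed.
Lemma limit_mul1 : left_id (into (1 : F 0%N)) mul.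
Proof.
move=> x; have [n [{}x ->]] := into_surj x.
by rewrite -(into1 n) limit_mulE mul1r.
Qed.
Lemma limit_mulD : left_distributive mul add.
Proof.
apply: into3 => n x y z.
by rewrite limit_addE !limit_mulE limit_addE mulrDl.
Qed.
Lemma limit_neq01 : into (1 : F 0%N) != into (0 : F 0%N).
Proof. by rewrite (inj_eq (@into_inj 0)) oner_neq0. Qed.
HB.instance Definition _ :=
  GRing.Zmodule_isComNzRing.Build limit limit_mulA limit_mulC limit_mul1
    limit_mulD limit_neq01.

Lemma limit_mulV (z : limit) : z != 0 -> mul (inv z) z = 1.
Proof.
have [n [x ->]] := into_surj z.
rewrite -[0](into0 n) (inj_eq (@into_inj n)) => xN0.
by rewrite limit_invE limit_mulE mulVf // into1.
Qed.
Lemma limit_inv0 : inv 0 = 0.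
Proof. by rewrite -[0](into0 0) limit_invE invr0. Qed.
HB.instance Definition _ :=
  GRing.ComNzRing_isField.Build limit limit_mulV limit_inv0.

Lemma into_is_zmod n : zmod_morphism (@into n).
Proof. by move=> x y; rewrite -limit_addE -limit_oppE. Qed.
Lemma into_is_monoid n : monoid_morphism (@into n).
Proof. by split=> [|x y]; [exact: into1 | rewrite -limit_mulE]. Qed.
HB.instance Definition _ n :=
  GRing.isZmodMorphism.Build _ _ (@into n) (@into_is_zmod n).
HB.instance Definition _ n :=
  GRing.isMonoidMorphism.Build _ _ (@into n) (@into_is_monoid n).

End DirectLimit.

(** A stage carries, besides its field, the tasks to be treated: stream number i
    enumerates the triples (a, b, c) of the field of stage i. *)
Record stage := Stage {
  stage_field :> fieldType;
  stage_task : nat -> nat -> stage_field * stage_field * stage_field;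
  stage_two : (2%:R : stage_field) != 0;
  stage_enum : enumerable stage_field }.

Definition keeps_nonsplit (F L : fieldType) (f : {rmorphism F -> L}) :=
  forall d e, nonsplit d e -> nonsplit (f d) (f e).

Definition map_task (F L : fieldType) (f : F -> L) (t : F * F * F) :=
  (f t.1.1, f t.1.2, f t.2).

(** Step n treats the task whose index is coded by n: c is made a slot of (a, b)
    when a, b are nonzero and c is a nonsquare.  Transporting the earlier streams
    keeps the old tasks available at all later steps. *)
Definition next_stage_spec n (s s' : stage) (f : {rmorphism s -> s'}) : Prop :=
  [/\ keeps_nonsplit f,
      forall i j, CodeSeq.decode n = [:: i; j] ->
        let: (a, b, c) := stage_task s i j in
        a != 0 -> b != 0 -> (forall t, t ^+ 2 != c) ->
        exists v, qf (pure_form (f a) (f b)) v = f c,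
      forall i j, (i <= n)%N -> stage_task s' i j = map_task f (stage_task s i j)
    & forall t, exists j, stage_task s' n.+1 j = t].

Lemma next_stage_exists n (s : stage) :
  exists p : {s' : stage & {rmorphism s -> s'}}, next_stage_spec n (tagged p).
Proof.
pose valid i j := let: (a, b, c) := stage_task s i j in
  [/\ a != 0, b != 0 & forall t, t ^+ 2 != c].
have [L [f [enL ns slot]]] : exists (L : fieldType) (f : {rmorphism s -> L}),
  [/\ enumerable L, keeps_nonsplit f & forall i j,
    CodeSeq.decode n = [:: i; j] -> valid i j ->
    let: (a, b, c) := stage_task s i j in
    exists v, qf (pure_form (f a) (f b)) v = f c].
  have [[i [j [dn vij]]]|nv] :=
      EM (exists i j, CodeSeq.decode n = [:: i; j] /\ valid i j).
    move: vij; rewrite /valid.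
    case tE: (stage_task s i j) => [[a b] c] [aN0 bN0 cns].
    have [L [f [enL ns slot]]] :=
      slot_extension (stage_enum s) (stage_two s) aN0 bN0 cns.
    exists L, f; split=> // i' j'; rewrite dn => -[<- <-] _.
    by rewrite tE.
  exists s, idfun; split=> [||i j dn vij]; [exact: stage_enum | by [] |].
  by case: nv; exists i, j.
have [e se] := enumerable_pair (enumerable_pair enL enL) enL.
have two : (2%:R : L) != 0 by rewrite -(rmorph_nat f) fmorph_eq0 stage_two.
pose task i j := if (i <= n)%N then map_task f (stage_task s i j) else e j.
exists (Tagged (fun s' : stage => {rmorphism s -> s'})
          (f : {rmorphism s -> @Stage L task two enL})).
split=> //= [i j dn|i j len|t]; last 2 first.
- by rewrite /task len.
- by have [j <-] := se t; exists j; rewrite /task ltnn.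
have := slot i j dn; rewrite /valid; case: (stage_task s i j) => [[a b] c] H *.
exact: H.
Qed.

Definition next_stage n (s : stage) := projT1 (cid (next_stage_exists n s)).

Lemma next_stageP n s : next_stage_spec n (tagged (next_stage n s)).
Proof. exact: (projT2 (cid (next_stage_exists n s))). Qed.

(** Every triple of the limit comes from some level i, hence is entry j of stream
    i, and is treated at step code [:: i; j], which is larger than i.  If c is a
    nonsquare in the limit, its representative is a nonsquare at that step, so
    that the step makes c a slot. *)
Theorem slot_closure (K : fieldType) : enumerable K -> (2%:R : K) != 0 ->
  exists (L : fieldType) (f : {rmorphism K -> L}), keeps_nonsplit f /\
    forall a b c : L, a != 0 -> b != 0 -> (forall s, s ^+ 2 != c) ->
      exists v, qf (pure_form a b) v = c.
Proof.
move=> enK two_neq0.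
have [e se] := enumerable_pair (enumerable_pair enK enK) enK.
pose s0 := @Stage K (fun i => e) two_neq0 enK.
pose fix st n : stage := if n is k.+1 then tag (next_stage k (st k)) else s0.
pose F n : fieldType := st n.
pose f n : {rmorphism F n -> F n.+1} := tagged (next_stage n (st n)).
have fP n : next_stage_spec n (f n) by exact: next_stageP.
pose L : fieldType := limit f; pose g n : {rmorphism F n -> L} := @into F f n.
have gf n x : g n.+1 (f n x) = g n x by exact: into_climb.
exists L, (g 0%N); split=> [d e' ns|a b c aN0 bN0 cns].
  have above n : exists d' e'' : F n,
      [/\ g n d' = g 0%N d, g n e'' = g 0%N e' & nonsplit d' e''].
    elim: n => [|n [d' [e'' [dE eE ns']]]]; first by exists d, e'.
    exists (f n d'), (f n e''); rewrite !gf; split=> //.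
    by have [k _ _ _] := fP n; apply: k.
  apply/nonsplitP => w x y z.
  have [n _ H] := @into_surj_above F f 0 [:: w; x; y; z].
  have [|w' ->] := H w; first by rewrite mem_head.
  have [|x' ->] := H x; first by rewrite !inE eqxx orbT.
  have [|y' ->] := H y; first by rewrite !inE eqxx !orbT.
  have [|z' ->] := H z; first by rewrite !inE eqxx !orbT.
  have [d' [e'' [<- <- /nonsplitP an]]] := above n.
  rewrite -!(rmorphXn (g n)) -!(rmorphM (g n)) -!(rmorphB (g n)) -(rmorphD (g n)).
  move/eqP; rewrite fmorph_eq0 => /eqP/an[-> -> -> ->].
  by rewrite (rmorph0 (g n)).
have [i _ H] := @into_surj_above F f 0 [:: a; b; c].
have [|a' aE] := H a; first by rewrite mem_head.
have [|b' bE] := H b; first by rewrite !inE eqxx orbT.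
have [|c' cE] := H c; first by rewrite !inE eqxx !orbT.
have [j tj] : exists j, stage_task (st i) i j = (a', b', c').
  case: (i) a' b' c' {aE bE cE H} => [|k] a' b' c'; first exact: se.
  by have [_ _ _] := fP k; apply.
have tn n : (i <= n)%N -> map_task (g n) (stage_task (st n) i j) = (a, b, c).
  elim: n => [|n IHn].
    rewrite leqn0 => /eqP i0; move: a' b' c' aE bE cE tj.
    by rewrite i0 => a' b' c' -> -> -> ->.
  rewrite leq_eqVlt => /predU1P[<-|lin].
    by rewrite tj aE bE cE.
  have [_ _ tS _] := fP n; rewrite [stage_task _ _ _]tS //.
  by rewrite -IHn // /map_task /= !gf.
pose n := CodeSeq.code [:: i; j].
have lin : (i <= n)%N.
  by have := CodeSeq.ltn_code [:: i; j]; rewrite /= => /andP[/ltnW].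
have [_ slot _ _] := fP n.
move: (slot i j (CodeSeq.codeK _)) (tn n lin).
case: (stage_task _ _ _) => [[a1 b1] c1] /= H1 [a1E b1E c1E].
have [||t|v vE] := H1.
- by apply: contraNneq aN0 => a10; rewrite -a1E a10 (rmorph0 (g n)).
- by apply: contraNneq bN0 => b10; rewrite -b1E b10 (rmorph0 (g n)).
- apply: contraNneq (cns (g n t)) => tc.
  by rewrite -(rmorphXn (g n)) tc; apply/eqP.
exists (g n.+1 \o v); rewrite -c1E -gf -vE rmorph_qf.
rewrite -a1E -b1E -(gf n a1) -(gf n b1); apply: eq_bigr => k _; congr (_ * _).
by rewrite (rmorph_pure_form (g n.+1)).
Qed.

(** * Quaternion symbols over a rational function field *)

Lemma size_qf_odd (F : fieldType) n (c : 'I_n -> F) P : anisotropic c ->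
  qf (polyC \o c) P != 0 -> odd (size (qf (polyC \o c) P)).
Proof.
move=> ac qN0; pose M := \max_i size (P i).
have leM i : (size (P i) <= M)%N by apply: (leq_bigmax i).
case ME : M leM => [|m] leM.
  case/eqP: qN0; rewrite /qf big1 // => i _.
  by have := leM i; rewrite leqn0 size_poly_eq0 => /eqP ->; rewrite expr0n mulr0.
suff -> : size (qf (polyC \o c) P) = m.*2.+1 by rewrite /= odd_double.
apply/eqP; rewrite eqn_leq size_qf //= ltnNge.
apply/negP => /(anisotropic_size ac) sP.
have : (M <= m)%N by apply/bigmax_leqP.
by rewrite ME ltnn.
Qed.

(** In w^2 - a x^2 = t (y^2 - a z^2) over F[t], the two sides have degrees of
    different parity, unless both vanish. *)
Lemma nonsplit_nonsquare_indeterminate (F : fieldType) (a : F) :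
  (forall s, s ^+ 2 != a) -> nonsplit (to_ratfun F a) ('X%:F).
Proof.
move=> nsa.
pose c (i : 'I_2) := nth 0 [:: 1; - a] i.
pose P (x y : {poly F}) (i : 'I_2) := nth 0 [:: x; y] i.
have qfE x y : qf (polyC \o c) (P x y) = x ^+ 2 - a%:P * y ^+ 2.
  by rewrite /qf !big_ord_recl big_ord0 /= /P /c /= rmorphN /=; ring.
have ac : anisotropic c.
  move=> v; rewrite /qf !big_ord_recl big_ord0 /= /c /= mul1r addr0 mulNr => e.
  have e2 : v ord0 ^+ 2 = a * v (lift ord0 ord0) ^+ 2.
    by apply/eqP; rewrite -subr_eq0 e.
  have v1 : v (lift ord0 ord0) = 0.
    apply/eqP/negPn/negP => v1.
    have /eqP := nsa (v ord0 / v (lift ord0 ord0)); apply.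
    by rewrite expr_div_n e2 mulfK // expf_neq0.
  have v0 : v ord0 = 0.
    by apply/eqP; move/eqP: e2; rewrite v1 expr0n mulr0 expf_eq0.
  case=> [[|[|//]]] i2.
    by rewrite -[RHS]v0; congr v; apply: val_inj.
  by rewrite -[RHS]v1; congr v; apply: val_inj.
have poly_case (w x y z : {poly F}) :
    w ^+ 2 - a%:P * x ^+ 2 - 'X * y ^+ 2 + a%:P * 'X * z ^+ 2 = 0 ->
    [/\ w = 0, x = 0, y = 0 & z = 0].
  move=> e.
  have {}e : qf (polyC \o c) (P w x) = qf (polyC \o c) (P y z) * 'X.
    by apply/eqP; rewrite -subr_eq0 !qfE -e; apply/eqP; ring.
  have [q0|qN0] := eqVneq (qf (polyC \o c) (P y z)) 0; last first.
    have := size_qf_odd ac qN0.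
    have := @size_qf_odd _ _ _ (P w x) ac.
    by rewrite e mulf_neq0 ?polyX_eq0 // size_mulX //= => /(_ isT) /negPf ->.
  have yz := anisotropic_poly ac q0.
  rewrite q0 mul0r in e; have wx := anisotropic_poly ac e.
  by split; [exact: (wx 0)|exact: (wx 1)|exact: (yz 0)|exact: (yz 1)].
apply/nonsplitP => w x y z e.
have [d [N [dN0 vd]]] := common_denominator (vec4 w x y z).
have [|N0 N1 N2 N3] := poly_case (N 0) (N 1) (N 2%:R) (N 3%:R).
  apply/eqP; rewrite -tofrac_eq0.
  rewrite !(tofracD, tofracB, tofracM, tofracXn, tofracN) -!vd /vec4 /=.
  apply/eqP.
  apply: etrans (etrans (congr1 (fun t => t * d%:F ^+ 2) e) (mul0r _)).
  by rewrite /to_ratfun /=; ring.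
have zero i : N i = 0 -> vec4 w x y z i = 0.
  move=> Ni; apply/eqP; have /eqP := vd i.
  by rewrite Ni tofrac0 mulf_eq0 tofrac_eq0 (negPf dN0) orbF.
by split; [exact: zero N0|exact: zero N1|exact: zero N2|exact: zero N3].
Qed.

Lemma mup_XsubC (k : fieldType) (x y : k) : mup x ('X - y%:P) = (y == x).
Proof. by rewrite -['X - _]expr1 mup_XsubCX; case: eqP. Qed.

(** In n^2 = f d^2 the multiplicities of r have different parities. *)
Lemma odd_multiplicity_nonsquare (k : fieldType) (f : {poly k}) (r : k)
    (s : {fraction {poly k}}) :
  f != 0 -> odd (mup r f) -> s ^+ 2 != f%:F.
Proof.
move=> fN0 of'; apply/eqP => sf.
have [d dN0 [n sd]] := fraction_num_den s.
have e : n ^+ 2 = f * d ^+ 2.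
  by apply/eqP; rewrite -tofrac_eq tofracXn -sd exprMn sf tofracM tofracXn.
have nN0 : n != 0.
  by apply: contra_eq_neq e => ->; rewrite expr0n eq_sym mulf_neq0 // expf_neq0.
have := congr1 (mup r) e; rewrite !expr2 !mupM ?mulf_neq0 // !addnn.
by move/(congr1 odd); rewrite oddD !odd_double of'.
Qed.

Section IndependentSymbols.
Variables (k : fieldType) (r : nat -> k).
Hypothesis r_inj : injective r.

Definition slot n : {fraction {poly k}} := ('X - (r n)%:P)%:F.

Lemma nonsplit_slot n :
  nonsplit (to_ratfun {fraction {poly k}} (slot n)) ('X%:F).
Proof.
apply: nonsplit_nonsquare_indeterminate => s.
apply: (@odd_multiplicity_nonsquare _ _ (r n)); first by rewrite polyXsubC_eq0.
by rewrite mup_XsubC eqxx.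
Qed.

Lemma nonsplit_slotM m n : m <> n ->
  nonsplit (to_ratfun {fraction {poly k}} (slot m)
            * to_ratfun {fraction {poly k}} (slot n)) ('X%:F).
Proof.
move=> nmn; rewrite -rmorphM; apply: nonsplit_nonsquare_indeterminate => s.
rewrite -tofracM; apply: (@odd_multiplicity_nonsquare _ _ (r n)).
  by rewrite mulf_neq0 ?polyXsubC_eq0.
rewrite mupM ?polyXsubC_eq0 // !mup_XsubC eqxx (inj_eq r_inj).
by case: eqP.
Qed.

End IndependentSymbols.

Lemma pchar_rmorph (R S : nzRingType) (f : {rmorphism R -> S}) p :
  p \in [pchar R] -> p \in [pchar S].
Proof.
rewrite !inE => /andP[-> /eqP p0] /=.
by rewrite -(rmorph_nat f) p0 rmorph0.
Qed.

Theorem independent_symbols (p : nat) : prime p ->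
  exists (K : fieldType) (a : nat -> K) (t : K),
    [/\ p \in [pchar K], enumerable K,
    forall n, nonsplit (a n) t & forall m n, m <> n -> nonsplit (a m * a n) t].
Proof.
move=> p_pr.
have [k [r [r_inj chark enk]]] : exists (k : fieldType) (r : nat -> k),
    [/\ injective r, p \in [pchar k] & enumerable k].
  exists {fraction {poly 'F_p}}, (fun n => ('X^n)%:F); split.
  - move=> m n /eqP; rewrite tofrac_eq => /eqP/(congr1 (size \o @polyseq _)).
    by rewrite /= !size_polyXn => -[].
  - exact: pchar_rmorph (to_ratfun 'F_p) _ (pchar_Fp p_pr).
  by apply/enumerable_fraction/enumerable_poly/(enumerable_count 0).
pose F := {fraction {poly k}}.
exists {fraction {poly F}}, (fun n => to_ratfun F (slot r n)), ('X%:F); split.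
- exact: pchar_rmorph (to_ratfun F \o to_ratfun k) _ chark.
- by do 2!apply/enumerable_fraction/enumerable_poly.
- exact: nonsplit_slot.
exact: nonsplit_slotM.
Qed.

(** * The algebra (a, b) in coordinates *)

(** The components are the coordinates on the basis 1, i, j, ij.  A product of
    copies of K inherits the vector space structure, but it also has its own
    componentwise multiplication, hence the type annotations in the laws below. *)
Definition quat (K : fieldType) (a b : K) : Type :=
  ((K^o * K^o) * (K^o * K^o))%type.

Section ConcreteQuaternions.
Variables (K : fieldType) (a b : K).
Local Notation Q := (quat a b).

HB.instance Definition _ := Vector.copy Q ((K^o * K^o) * (K^o * K^o))%type.

Definition quat_mk (w x y z : K) : Q := ((w, x), (y, z)).
Definition quat_one : Q := quat_mk 1 0 0 0.
Definition quat_mul (p q : Q) : Q :=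
  let: ((w, x), (y, z)) := p : (K * K) * (K * K) in
  let: ((w', x'), (y', z')) := q : (K * K) * (K * K) in
  quat_mk (w * w' + a * x * x' + b * y * y' - a * b * z * z')
          (w * x' + x * w' - b * y * z' + b * z * y')
          (w * y' + y * w' + a * x * z' - a * z * x')
          (w * z' + z * w' + x * y' - y * x').

Lemma quat_eq (w x y z w' x' y' z' : K) :
  w = w' -> x = x' -> y = y' -> z = z' ->
  quat_mk w x y z = quat_mk w' x' y' z'.
Proof. by move=> -> -> -> ->. Qed.

Lemma quat_addE (w x y z w' x' y' z' : K) :
  quat_mk w x y z + quat_mk w' x' y' z'
  = quat_mk (w + w') (x + x') (y + y') (z + z').
Proof. by []. Qed.

Lemma quat_oppE (w x y z : K) :
  - quat_mk w x y z = quat_mk (- w) (- x) (- y) (- z).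
Proof. by []. Qed.

Lemma quat_scaleE (c w x y z : K) :
  c *: quat_mk w x y z = quat_mk (c * w) (c * x) (c * y) (c * z).
Proof. by []. Qed.

Lemma quat_mulE (w x y z w' x' y' z' : K) :
  quat_mul (quat_mk w x y z) (quat_mk w' x' y' z') =
  quat_mk (w * w' + a * x * x' + b * y * y' - a * b * z * z')
          (w * x' + x * w' - b * y * z' + b * z * y')
          (w * y' + y * w' + a * x * z' - a * z * x')
          (w * z' + z * w' + x * y' - y * x').
Proof. by []. Qed.

Lemma quat_ind (P : Q -> Prop) :
  (forall w x y z, P (quat_mk w x y z)) -> forall q, P q.
Proof. by move=> H [[w x] [y z]]; exact: (H w x y z). Qed.

Lemma quat_mulA : associative quat_mul.
Proof.
elim/quat_ind=> w x y z; elim/quat_ind=> w' x' y' z'; elim/quat_ind=> w'' x'' y'' z''.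
by rewrite !quat_mulE; apply: quat_eq; ring.
Qed.
Lemma quat_mul1 : left_id quat_one quat_mul.
Proof. by elim/quat_ind=> w x y z; rewrite quat_mulE; apply: quat_eq; ring. Qed.
Lemma quat_mulr1 : right_id quat_one quat_mul.
Proof. by elim/quat_ind=> w x y z; rewrite quat_mulE; apply: quat_eq; ring. Qed.
Lemma quat_mulDl : left_distributive quat_mul +%R.
Proof.
elim/quat_ind=> w x y z; elim/quat_ind=> w' x' y' z'; elim/quat_ind=> w'' x'' y'' z''.
by rewrite !(quat_mulE, quat_addE); apply: quat_eq; ring.
Qed.
Lemma quat_mulDr : right_distributive quat_mul +%R.
Proof.
elim/quat_ind=> w x y z; elim/quat_ind=> w' x' y' z'; elim/quat_ind=> w'' x'' y'' z''.
by rewrite !(quat_mulE, quat_addE); apply: quat_eq; ring.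
Qed.
Lemma quat_one_neq0 : quat_one != 0.
Proof. by apply/eqP => -[] /eqP; rewrite oner_eq0. Qed.
HB.instance Definition _ := GRing.Zmodule_isNzRing.Build Q
  quat_mulA quat_mul1 quat_mulr1 quat_mulDl quat_mulDr quat_one_neq0.

Lemma quat_mkM (w x y z w' x' y' z' : K) :
  quat_mk w x y z * quat_mk w' x' y' z' =
  quat_mk (w * w' + a * x * x' + b * y * y' - a * b * z * z')
          (w * x' + x * w' - b * y * z' + b * z * y')
          (w * y' + y * w' + a * x * z' - a * z * x')
          (w * z' + z * w' + x * y' - y * x').
Proof. by []. Qed.

Lemma quat_scaleAl (c : K) (p q : Q) : c *: (p * q : Q) = (c *: p : Q) * q :> Q.
Proof.
elim/quat_ind: p => w x y z; elim/quat_ind: q => w' x' y' z'.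
by rewrite !(quat_mkM, quat_scaleE); apply: quat_eq; ring.
Qed.
HB.instance Definition _ := GRing.Lmodule_isLalgebra.Build K Q quat_scaleAl.
Lemma quat_scaleAr (c : K) (p q : Q) : c *: (p * q : Q) = p * (c *: q : Q) :> Q.
Proof.
elim/quat_ind: p => w x y z; elim/quat_ind: q => w' x' y' z'.
by rewrite !(quat_mkM, quat_scaleE); apply: quat_eq; ring.
Qed.
HB.instance Definition _ := GRing.Lalgebra_isAlgebra.Build K Q quat_scaleAr.
HB.instance Definition _ := Algebra_isFalgebra.Build K Q.


Definition quat_i : Q := quat_mk 0 1 0 0.
Definition quat_j : Q := quat_mk 0 0 1 0.

Lemma quat_generators : [/\ quat_i ^+ 2 = a%:A, quat_j ^+ 2 = b%:A,
  quat_j * quat_i = - (quat_i * quat_j)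
  & basis_of {:Q : falgType K} [:: 1; quat_i; quat_j; quat_i * quat_j]].
Proof.
have oneE : (1 : Q) = quat_mk 1 0 0 0 by [].
rewrite /quat_i /quat_j; split.
- by rewrite expr2 quat_mkM oneE quat_scaleE; apply: quat_eq; ring.
- by rewrite expr2 quat_mkM oneE quat_scaleE; apply: quat_eq; ring.
- rewrite !quat_mkM quat_oppE; apply: quat_eq; ring.
rewrite basisEdim; apply/andP; split; last by rewrite dimvf.
apply/subvP; elim/quat_ind=> w x y z _.
have -> : quat_mk w x y z = w *: (1 : Q) + x *: quat_mk 0 1 0 0
    + y *: quat_mk 0 0 1 0 + z *: (quat_mk 0 1 0 0 * quat_mk 0 0 1 0).
  by rewrite quat_mkM oneE !quat_scaleE !quat_addE; apply: quat_eq => /=; ring.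
by do ?apply: memvD; apply/memvZ/memv_span; rewrite !inE eqxx ?orbT.
Qed.

Lemma quat_division : nonsplit a b -> forall q : Q, q != 0 -> q \is a GRing.unit.
Proof.
move=> /nonsplitP ns; elim/quat_ind=> w x y z qN0.
pose N := w ^+ 2 - a * x ^+ 2 - b * y ^+ 2 + a * b * z ^+ 2.
have NN0 : N != 0.
  by apply: contraNneq qN0 => /ns[-> -> -> ->]; apply/eqP.
apply/unitrP; exists (quat_mk (w / N) (- x / N) (- y / N) (- z / N)).
have oneE : (1 : Q) = quat_mk 1 0 0 0 by [].
rewrite oneE !quat_mkM.
by split; apply: quat_eq; rewrite /N; field.
Qed.

Lemma quat_central : (2%:R : K) != 0 -> b != 0 ->
  'Z({:Q : falgType K})%VS = 1%VS :> {vspace (Q : falgType K)}.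
Proof.
move=> two_neq0 bN0; apply/eqP; rewrite eqEsubv.
apply/andP; split; last first.
  apply/subvP => _ /vlineP[k ->]; rewrite memv_cap memvf; apply/centvP => q _.
  by rewrite -scalerAl -scalerAr mul1r mulr1.
apply/subvP => q; rewrite memv_cap => /andP[_ /centvP qC].
elim/quat_ind: q qC => w x y z qC.
have := qC (quat_mk 0 1 0 0) (memvf _); have := qC (quat_mk 0 0 1 0) (memvf _).
rewrite !quat_mkM => -[_ ez _ ex] [_ _ _ ey].
have double0 (c k : K) : k != 0 -> 2%:R * (k * c) = 0 -> c = 0.
  by move=> kN0 /eqP; rewrite !mulf_eq0 (negPf two_neq0) (negPf kN0) => /eqP.
have x0 : x = 0.
  apply: (double0 _ 1 (oner_neq0 _)); apply/eqP; move/eqP: ex.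
  by rewrite -subr_eq0; congr (_ == 0); ring.
have y0 : y = 0.
  apply: (double0 _ 1 (oner_neq0 _)); apply/eqP; move/eqP: ey.
  by rewrite -subr_eq0 -oppr_eq0; congr (_ == 0); ring.
have z0 : z = 0.
  apply: (double0 _ b bN0); apply/eqP; move/eqP: ez.
  by rewrite -subr_eq0; congr (_ == 0); ring.
have -> : quat_mk w x y z = w *: (1 : Q).
  have oneE : (1 : Q) = quat_mk 1 0 0 0 by [].
  by rewrite oneE quat_scaleE; apply: quat_eq; rewrite ?x0 ?y0 ?z0; ring.
exact: memvZ (memv_line _).
Qed.

End ConcreteQuaternions.

(** * Coordinates in a quaternion algebra, and its quadratic subfields *)

Section StandardGenerators.
Variables (K : fieldType) (D : falgType K) (a b : K) (i j : D).
Hypotheses (aN0 : a != 0) (bN0 : b != 0).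
Hypotheses (i2 : i ^+ 2 = a%:A) (j2 : j ^+ 2 = b%:A) (ji : j * i = - (i * j)).
Hypothesis base : basis_of {:D} [:: 1; i; j; i * j].

Definition comb (w x y z : K) : D := w%:A + x *: i + y *: j + z *: (i * j).

Lemma combD w x y z w' x' y' z' : comb w x y z + comb w' x' y' z' =
  comb (w + w') (x + x') (y + y') (z + z').
Proof.
rewrite /comb !scalerDl.
by rewrite [LHS]addrACA; congr (_ + _); rewrite [LHS]addrACA; congr (_ + _);
   rewrite [LHS]addrACA.
Qed.

Lemma combZ c w x y z : c *: comb w x y z = comb (c * w) (c * x) (c * y) (c * z).
Proof. by rewrite /comb !scalerDr !scalerA. Qed.

Lemma comb_exists v : exists w x y z, v = comb w x y z.
Proof.
pose t : 4.-tuple D := [tuple 1; i; j; i * j].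
have : v \in <<t>>%VS by rewrite (span_basis base) memvf.
move=> /coord_span ->; rewrite !big_ord_recl big_ord0 /= addr0 !addrA.
by do 4!eexists.
Qed.

Lemma comb_inj w x y z w' x' y' z' : comb w x y z = comb w' x' y' z' ->
  [/\ w = w', x = x', y = y' & z = z'].
Proof.
move=> e.
have /freeP fr : free [tuple 1; i; j; i * j] by rewrite (basis_free base).
have {}e : comb (w - w') (x - x') (y - y') (z - z') = 0.
  rewrite -combD e -[in X in X + _ = _](scale1r (comb w' x' y' z')).
  have -> : comb (- w') (- x') (- y') (- z') = (- 1) *: comb w' x' y' z'.
    by rewrite combZ !mulN1r.
  by rewrite -scalerDl subrr scale0r.
pose k (n : 'I_4) := nth 0 [:: w - w'; x - x'; y - y'; z - z'] n.
have kE n : k n = 0.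
  apply: fr; rewrite -[RHS]e /comb !big_ord_recl big_ord0 /= addr0 !addrA //.
have e0 := kE 0; have e1 := kE 1; have e2 := kE 2%:R; have e3 := kE 3%:R.
by split; apply/eqP; rewrite -subr_eq0; apply/eqP.
Qed.

Lemma iiE (v : D) : i * (i * v) = a *: v.
Proof. by rewrite mulrA -expr2 i2 -scalerAl mul1r. Qed.

Lemma mul_i_comb w x y z : i * comb w x y z = comb (a * x) w (a * z) y.
Proof.
rewrite /comb !mulrDr -!scalerAr iiE mulr1 -expr2 i2 !scalerA.
rewrite [x * a]mulrC [z * a]mulrC.
by rewrite -!addrA [RHS]addrCA; congr (_ + _); congr (_ + _); rewrite addrC.
Qed.

Lemma mul_j_comb w x y z : j * comb w x y z = comb (b * y) (- (b * z)) w (- x).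
Proof.
have jij : j * (i * j) = - (b *: i).
  by rewrite mulrA ji mulNr -mulrA -expr2 j2 -scalerAr mulr1.
rewrite /comb !mulrDr -!scalerAr mulr1 -expr2 j2 ji jij scalerA !scalerN scalerA.
rewrite [y * b]mulrC [z * b]mulrC !scaleNr -!addrA.
by rewrite [LHS]addrC -!addrA addrCA; congr (_ + _); rewrite addrC addrA.
Qed.

Lemma combM w x y z w' x' y' z' : comb w x y z * comb w' x' y' z' =
  comb (w * w' + a * x * x' + b * y * y' - a * b * z * z')
       (w * x' + x * w' - b * y * z' + b * z * y')
       (w * y' + y * w' + a * x * z' - a * z * x')
       (w * z' + z * w' + x * y' - y * x').
Proof.
rewrite {1}/comb !mulrDl -!scalerAl mul1r -(mulrA i j) mul_j_comb !mul_i_comb.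
by rewrite !combZ !combD; congr comb; ring.
Qed.

Lemma comb_scalar w : comb w 0 0 0 = w%:A.
Proof. by rewrite /comb !scale0r !addr0. Qed.

Lemma pure_sqr x y z :
  comb 0 x y z ^+ 2 = (a * x ^+ 2 + b * y ^+ 2 - a * b * z ^+ 2)%:A.
Proof. by rewrite expr2 combM -comb_scalar; congr comb; ring. Qed.

Hypothesis two_neq0 : (2%:R : K) != 0.
Hypothesis divD : forall v : D, v != 0 -> v \is a GRing.unit.

(** The commutator of v and u is, up to factors 2, a and b, the vector product of
    their pure parts, so these are proportional when u and v commute. *)
Lemma centralizer_pure x y z v : let u := comb 0 x y z in
  u != 0 -> v * u = u * v -> exists al be, v = al%:A + be *: u.
Proof.
move=> u uN0 vu; pose c := a * x ^+ 2 + b * y ^+ 2 - a * b * z ^+ 2.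
have u2 : u ^+ 2 = c%:A by exact: pure_sqr.
have cN0 : c != 0.
  apply: contraNneq uN0 => c0; have : u ^+ 2 = 0 by rewrite u2 c0 scale0r.
  case: eqVneq => // uN0 u20; have := unitrX 2 (divD uN0).
  by rewrite u20 unitr0.
have [w [x' [y' [z' vE]]]] := comb_exists v.
pose s := a * x * x' + b * y * y' - a * b * z * z'.
exists w, (s / c); rewrite -comb_scalar combZ combD vE.
have := vu; rewrite vE /u !combM => /comb_inj[_ e1 e2 e3].
have half (p q : K) : 2%:R * p = 2%:R * q -> p = q by move=> /(mulfI two_neq0).
have f1 : y * z' = z * y'.
  apply: (mulfI bN0); apply: half; apply/eqP; move/eqP: e1.
  by rewrite -subr_eq0 -[in X in _ -> X]subr_eq0; congr (_ == 0); ring.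
have f2 : x * z' = z * x'.
  apply: (mulfI aN0); apply: half; apply/eqP; move/eqP: e2.
  by rewrite -subr_eq0 -oppr_eq0 -[in X in _ -> X]subr_eq0; congr (_ == 0); ring.
have f3 : x * y' = y * x'.
  apply: half; apply/eqP; move/eqP: e3.
  by rewrite -subr_eq0 -oppr_eq0 -[in X in _ -> X]subr_eq0; congr (_ == 0); ring.
congr comb; rewrite ?addr0 ?add0r ?mulr0 ?addr0 //; apply: (mulIf cN0).
- rewrite mulrAC divfK //; apply/eqP; rewrite -subr_eq0 /c /s.
  rewrite -[X in X == 0](_ : b * y * (y * x' - x * y') + a * b * z * (x * z' - z * x') = _).
    by rewrite f2 f3 !subrr !mulr0 addr0.
  by ring.
- rewrite mulrAC divfK //; apply/eqP; rewrite -subr_eq0 /c /s.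
  rewrite -[X in X == 0](_ : a * x * (x * y' - y * x') + a * b * z * (y * z' - z * y') = _).
    by rewrite f1 f3 !subrr !mulr0 addr0.
  by ring.
rewrite mulrAC divfK //; apply/eqP; rewrite -subr_eq0 /c /s.
rewrite -[X in X == 0](_ : a * x * (x * z' - z * x') + b * y * (y * z' - z * y') = _).
  by rewrite f1 f2 !subrr !mulr0 addr0.
by ring.
Qed.

Lemma comb_notin1 x y z : comb 0 x y z != 0 -> comb 0 x y z \notin 1%VS.
Proof.
move=> uN0; apply/negP => /vlineP[k]; rewrite -comb_scalar => /comb_inj[_ x0 y0 z0].
by case/eqP: uN0; rewrite x0 y0 z0 comb_scalar scale0r.
Qed.

Lemma comb_decomp v : v \notin 1%VS -> exists k x y z,
  v = k%:A + comb 0 x y z /\ comb 0 x y z != 0.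
Proof.
move=> vN1; have [w [x [y [z vE]]]] := comb_exists v.
exists w, x, y, z; rewrite -comb_scalar combD vE addr0 !add0r; split=> //.
apply: contraNneq vN1 => u0; rewrite vE -[w]addr0 -[x]add0r -[y]add0r -[z]add0r.
by rewrite -combD u0 addr0 comb_scalar memvZ ?memv_line.
Qed.

Lemma i_neq0 : comb 0 1 0 0 != 0.
Proof.
apply/eqP; have -> : 0 = comb 0 0 0 0 by rewrite comb_scalar scale0r.
by move/comb_inj => [_ /eqP]; rewrite oner_eq0.
Qed.

End StandardGenerators.

Section QuadraticSubfields.
Variables (K : fieldType) (D : falgType K).
Hypothesis divD : forall v : D, v != 0 -> v \is a GRing.unit.
Variables (u : D) (c : K).
Hypotheses (u2 : u ^+ 2 = c%:A) (uN1 : u \notin 1%VS).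

Let V := (1 + <[u]>)%VS.

Lemma mem_quadratic v : reflect (exists al be, v = al%:A + be *: u) (v \in V).
Proof.
apply: (iffP memv_addP) => [[p /vlineP[al ->] [q /vlineP[be ->] ->]]|[al [be ->]]].
  by exists al, be.
exists al%:A; rewrite ?memvZ ?memv_line //.
by exists (be *: u); rewrite ?memvZ ?memv_line.
Qed.

Lemma quadraticM al be ga de : (al%:A + be *: u) * (ga%:A + de *: u) =
  (al * ga + be * de * c)%:A + (al * de + be * ga) *: u.
Proof.
rewrite mulrDl !mulrDr -!scalerAl -!scalerAr !mul1r mulr1 -expr2 u2 !scalerA.
by rewrite !scalerDl -!addrA; congr (_ + _); rewrite addrA addrC.
Qed.

Lemma quadratic_inj al be : al%:A + be *: u = 0 -> al = 0 /\ be = 0.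
Proof.
move=> e; have be0 : be = 0.
  apply/eqP/negPn/negP => beN0; case/negP: uN1.
  rewrite -[u](scalerK beN0) memvZ //.
  have -> : be *: u = (- al)%:A by apply/eqP; rewrite scaleNr -addr_eq0 addrC e.
  by rewrite memvZ ?memv_line.
split=> //; move: e; rewrite be0 scale0r addr0 => /eqP.
by rewrite scaler_eq0 oner_eq0 orbF => /eqP.
Qed.

(** The inverse of al + be u is a multiple of al - be u, as their product is a
    nonzero scalar. *)
Lemma quadratic_subfield :
  exists A : {aspace D}, (A : {vspace D}) = V /\ subfield_over A.
Proof.
have sub1 : (1 <= V)%VS by exact: addvSl.
have isA : is_aspace V.
  apply/andP; split; first by apply: has_algid1; rewrite -memvE in sub1.
  apply/prodvP => _ _ /mem_quadratic[al [be ->]] /mem_quadratic[ga [de ->]].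
  by rewrite quadraticM; apply/mem_quadratic; do 2!eexists.
exists (ASpace isA); split=> //; split=> //=.
  move=> _ _ /mem_quadratic[al [be ->]] /mem_quadratic[ga [de ->]].
  by rewrite !quadraticM; congr (_%:A + _ *: u); ring.
move=> v vA vN0; have vU := divD vN0; split=> //.
have /mem_quadratic[al [be vE]] := vA.
pose w := al%:A + (- be) *: u; pose n := al ^+ 2 - be ^+ 2 * c.
have vw : v * w = n%:A.
  rewrite vE quadraticM [X in _ + X *: u](_ : _ = 0); last by ring.
  by rewrite scale0r addr0; congr (_%:A); rewrite /n; ring.
have nN0 : n != 0.
  apply: contraNneq vN0 => n0; rewrite n0 scale0r in vw.
  have w0 : w = 0 by rewrite -[w](mulKr vU) vw mulr0.
  have [al0 /eqP] := quadratic_inj w0; rewrite oppr_eq0 => /eqP be0.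
  by rewrite vE al0 be0 !scale0r addr0.
have -> : v^-1 = n^-1 *: w.
  apply: (mulrI vU); rewrite mulrV // -scalerAr vw scalerA mulVf //.
  by rewrite scale1r.
by apply: memvZ; apply/mem_quadratic; do 2!eexists.
Qed.

End QuadraticSubfields.

(** * Maximal subfields and isomorphisms *)

Section MaximalSubfields.
Variables (K : fieldType) (D : falgType K) (a b : K) (i j : D).
Hypotheses (aN0 : a != 0) (bN0 : b != 0).
Hypotheses (i2 : i ^+ 2 = a%:A) (j2 : j ^+ 2 = b%:A) (ji : j * i = - (i * j)).
Hypothesis base : basis_of {:D} [:: 1; i; j; i * j].
Hypothesis two_neq0 : (2%:R : K) != 0.
Hypothesis divD : forall v : D, v != 0 -> v \is a GRing.unit.

Lemma subfield_pure (F : {aspace D}) x y z : let u := comb i j 0 x y z in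
  u != 0 -> subfield_over F -> u \in F -> (F : {vspace D}) = (1 + <[u]>)%VS.
Proof.
move=> u uN0 [F1 Fcomm _] uF; apply: subv_anti; apply/andP; split.
  apply/subvP => v vF; apply/mem_quadratic.
  apply: (centralizer_pure aN0 bN0 i2 j2 ji base two_neq0 divD uN0); exact: Fcomm.
by rewrite subv_add F1 -memvE.
Qed.

Lemma pure_maximal_subfield x y z : let u := comb i j 0 x y z in
  u != 0 -> exists A : {aspace D},
    (A : {vspace D}) = (1 + <[u]>)%VS /\ maximal_subfield A.
Proof.
move=> u uN0; have u2 := pure_sqr i2 j2 ji x y z.
have [A [AE sA]] := quadratic_subfield divD u2 (comb_notin1 base uN0).
exists A; split=> //; split=> // F sF AF; rewrite AE; apply: subfield_pure => //.
by rewrite (subvP AF) // AE (subvP (addvSr _ _)) ?memv_line.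
Qed.

(** A maximal subfield is not reduced to the scalars, since K(i) is larger; the
    pure part of any nonscalar element generates it. *)
Lemma maximal_subfield_pure (E : {aspace D}) : maximal_subfield E ->
  exists x y z, let u := comb i j 0 x y z in
    u != 0 /\ (E : {vspace D}) = (1 + <[u]>)%VS.
Proof.
move=> [sE maxE]; have [E1 _ _] := sE.
have [[v vE vN1]|nE] := EM (exists2 v, v \in E & v \notin 1%VS).
  have [k [x [y [z [vk uN0]]]]] := comb_decomp base vN1.
  exists x, y, z; split=> //; apply: subfield_pure => //.
  have -> : comb i j 0 x y z = v - k%:A by rewrite vk addrAC subrr add0r.
  by rewrite memvB // (subvP E1) // memvZ ?memv_line.
have iN0 := i_neq0 base; exists 1, 0, 0; split=> //=.
have [A [AE [sA _]]] := pure_maximal_subfield iN0.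
have EA : (E <= A)%VS.
  apply/subvP => v vE; rewrite AE (subvP (addvSl _ _)) //.
  by apply/negPn/negP => vN1; apply: nE; exists v.
by rewrite -(maxE A sA EA).
Qed.

End MaximalSubfields.

(** If s^2 = c, then u - s and u + s are zero divisors. *)
Lemma root_nonsquare (K : fieldType) (D : falgType K) (u : D) (c : K) :
  (forall v : D, v != 0 -> v \is a GRing.unit) ->
  u ^+ 2 = c%:A -> u \notin 1%VS -> forall s, s ^+ 2 != c.
Proof.
move=> divD u2 uN1 s; apply: contraNneq uN1 => sc.
have e : (u - s%:A) * (u + s%:A) = 0.
  rewrite mulrDr !mulrBl -!scalerAl -!scalerAr !mul1r !mulr1 -expr2 u2 -sc.
  rewrite expr2 scalerA.
  by rewrite addrA subrK subrr.
have [d0|dN0] := eqVneq (u - s%:A) 0.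
  by move/eqP: d0; rewrite subr_eq0 => /eqP ->; rewrite memvZ ?memv_line.
have : u + s%:A = 0 by rewrite -[LHS](mulKr (divD _ dN0)) e mulr0.
by move/eqP; rewrite addr_eq0 => /eqP ->; rewrite memvN memvZ ?memv_line.
Qed.

Section QuadraticIsomorphism.
Variables (K : fieldType) (c : K).

Definition generates_quadratic (A : falgType K) (r : A) :=
  [/\ r ^+ 2 = c%:A, r \notin 1%VS
    & forall x, exists p : K * K, x = p.1%:A + p.2 *: r].

Variables (A B : falgType K) (r : A) (s : B).
Hypotheses (qr : generates_quadratic r) (qs : generates_quadratic s).

Let coords x := let: And3 _ _ g := qr in projT1 (cid (g x)).
Definition quadratic_map (x : A) : B := (coords x).1%:A + (coords x).2 *: s.

Lemma quadratic_mapE al be : quadratic_map (al%:A + be *: r) = al%:A + be *: s.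
Proof.
rewrite /quadratic_map /coords; case: qr => r2 rN1 g.
case: cid => -[al' be'] /= e.
have : (al - al')%:A + (be - be') *: r = 0.
  by rewrite !scalerBl addrACA -opprD -e subrr.
case/(quadratic_inj rN1) => /eqP; rewrite subr_eq0 => /eqP -> /eqP.
by rewrite subr_eq0 => /eqP ->.
Qed.

Lemma quadratic_map_linear : linear quadratic_map.
Proof.
case: (qr) => _ _ g k x y; have [[al be] ->] := g x; have [[ga de] ->] := g y.
rewrite /= scalerDr !scalerA addrACA -!scalerDl !quadratic_mapE.
by rewrite scalerDr !scalerA addrACA -!scalerDl.
Qed.

Lemma quadratic_map_monoid : monoid_morphism quadratic_map.
Proof.
case: (qr) => r2 _ g; case: (qs) => s2 _ _; split.
  have -> : 1 = 1%:A + 0 *: r :> A by rewrite scale1r scale0r addr0.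
  by rewrite quadratic_mapE scale1r scale0r addr0.
move=> x y; have [[al be] ->] := g x; have [[ga de] ->] := g y.
by rewrite (quadraticM r2) !quadratic_mapE (quadraticM s2).
Qed.

End QuadraticIsomorphism.

Lemma quadratic_mapK (K : fieldType) (c : K) (A B : falgType K) (r : A) (s : B)
    (qr : generates_quadratic c r) (qs : generates_quadratic c s) :
  cancel (quadratic_map s qr) (quadratic_map r qs).
Proof.
move=> x; have [_ _ g] := qr; have [p ->] := g x.
by rewrite (quadratic_mapE s qr) (quadratic_mapE r qs).
Qed.

Lemma quadratic_iso (K : fieldType) (c : K) (A B : falgType K) (r : A) (s : B) :
  generates_quadratic c r -> generates_quadratic c s -> alg_isomorphic A B.
Proof.
move=> qr qs.
pose lin := GRing.isLinear.Build K A B *:%R (quadratic_map s qr)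
  (@quadratic_map_linear _ _ _ _ _ s qr).
pose mon := GRing.isMonoidMorphism.Build A B (quadratic_map s qr)
  (quadratic_map_monoid qr qs).
pose f : {lrmorphism A -> B} := HB.pack (quadratic_map s qr) lin mon.
by exists f; exists (quadratic_map r qs); exact: quadratic_mapK.
Qed.

Lemma subvs_generates_quadratic (K : fieldType) (D : falgType K) (E : {aspace D})
    (u : D) (c : K) : (E : {vspace D}) = (1 + <[u]>)%VS ->
  u ^+ 2 = c%:A -> u \notin 1%VS ->
  exists r : subvs_of E, generates_quadratic c r.
Proof.
move=> EV u2 uN1.
have uE : u \in E by rewrite EV (subvP (addvSr _ _)) ?memv_line.
have oneE : 1 \in E by rewrite EV (subvP (addvSl _ _)) ?memv_line.
have val1 : vsval (1 : subvs_of E) = 1 by apply/eqP; rewrite -algid_eq1 in oneE.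
have valZ k (x : subvs_of E) : vsval (k *: x) = k *: vsval x by rewrite linearZ.
have valD (x y : subvs_of E) : vsval (x + y) = vsval x + vsval y by rewrite linearD.
exists (Subvs uE); split.
- by apply: val_inj; rewrite [RHS]valZ val1 -u2.
- apply: contraNN uN1 => /vlineP[k /(congr1 vsval)].
  by rewrite valZ val1 /= => ->; rewrite memvZ ?memv_line.
move=> x; have : vsval x \in (1 + <[u]>)%VS by rewrite -EV subvsP.
case/mem_quadratic => al [be xE]; exists (al, be); apply: val_inj.
by rewrite [RHS]valD !valZ val1.
Qed.

Lemma alg_isomorphic_trans (K : fieldType) (A B C : falgType K) :
  alg_isomorphic A B -> alg_isomorphic B C -> alg_isomorphic A C.
Proof.
move=> [f bf] [g bg]; exists (g \o f : {lrmorphism _ -> _}); exact: bij_comp.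
Qed.

Section WeakIsomorphism.
Variable K : fieldType.
Hypothesis two_neq0 : (2%:R : K) != 0.
Hypothesis slots : forall a b c : K, a != 0 -> b != 0 ->
  (forall s, s ^+ 2 != c) -> exists v, qf (pure_form a b) v = c.

(** A maximal subfield of D is K(sqrt c) with c a nonsquare; by hypothesis c is
    also the square of a pure quaternion of D'. *)
Lemma Max_transfer (D D' : falgType K) : Quat D -> Quat D' ->
  forall L, Max D L -> Max D' L.
Proof.
move=> [[a [b [i [j [[aN0 bN0] i2 j2 ji base]]]]] [divD _]].
move=> [[a' [b' [i' [j' [[aN0' bN0'] i2' j2' ji' base']]]]] [divD' _]].
move=> L [E [maxE isoEL]].
have [x [y [z [uN0 EV]]]] :=
  maximal_subfield_pure aN0 bN0 i2 j2 ji base two_neq0 divD maxE.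
have u2 := pure_sqr i2 j2 ji x y z.
have uN1 := comb_notin1 base uN0.
have cns := root_nonsquare divD u2 uN1.
have [v] := slots aN0' bN0' cns; rewrite (eq_qf _ (vec3E v)) qf_pure_form => vc.
have u2' := pure_sqr i2' j2' ji' (v 0) (v 1) (v 2%:R); rewrite vc in u2'.
have uN0' : comb i' j' 0 (v 0) (v 1) (v 2%:R) != 0.
  apply: contraNneq (cns 0) => u0; move: u2'.
  rewrite u0 expr2 mul0r => /esym/eqP.
  rewrite scaler_eq0 oner_eq0 orbF => /eqP ->.
  by rewrite expr2 mul0r.
have [A [AV maxA]] :=
  pure_maximal_subfield aN0' bN0' i2' j2' ji' base' two_neq0 divD' uN0'.
exists A; split=> //; apply: alg_isomorphic_trans isoEL.
have [r qr] := subvs_generates_quadratic AV u2' (comb_notin1 base' uN0').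
have [s qs] := subvs_generates_quadratic EV u2 uN1.
exact: quadratic_iso qr qs.
Qed.

End WeakIsomorphism.

(** An isomorphism from (a, b) to (a', b) carries j to a square root J of b, and
    J is conjugate to j' by J + j' (or is - j').  So some element I' of (a', b)
    with square a anticommutes with j', which forces I' = x i' + z i' j' and
    a = a' (x^2 - b z^2).  Hence a a' is a norm from K(sqrt b). *)
Lemma common_slot_split (K : fieldType) (a a' b : K) (D D' : falgType K)
    (i j : D) (i' j' : D') :
    (2%:R : K) != 0 -> a' != 0 -> b != 0 ->
    i ^+ 2 = a%:A -> j ^+ 2 = b%:A -> j * i = - (i * j) ->
    i' ^+ 2 = a'%:A -> j' ^+ 2 = b%:A -> j' * i' = - (i' * j') ->
    basis_of {:D'} [:: 1; i'; j'; i' * j'] ->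
    (forall v : D', v != 0 -> v \is a GRing.unit) ->
  alg_isomorphic D D' -> ~ nonsplit (a * a') b.
Proof.
move=> two_neq0 aN0' bN0 i2 j2 ji i2' j2' ji' base' div' [f _] /nonsplitP ns.
pose I := f i; pose J := f j.
have I2 : I ^+ 2 = a%:A by rewrite -rmorphXn i2 /= linearZ /= rmorph1.
have J2 : J ^+ 2 = b%:A by rewrite -rmorphXn j2 /= linearZ /= rmorph1.
have JI : J * I = - (I * J) by rewrite -!rmorphM ji rmorphN.
have [I' I2' jI'] : exists2 I', I' ^+ 2 = a%:A & j' * I' = - (I' * j').
  have [m0|mN0] := eqVneq (J + j') 0.
    have {m0}-> : j' = - J by apply/eqP; rewrite -addr_eq0 addrC m0.
    by exists I; rewrite // mulNr JI mulrN.
  have mU := div' _ mN0; set m := J + j' in mU.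
  have Jm : J * m = m * j' by rewrite mulrDr mulrDl -!expr2 J2 j2' addrC.
  have jm : j' * m^-1 = m^-1 * J.
    by apply: (mulrI mU); rewrite [LHS]mulrA -Jm mulrK // mulVKr.
  exists (m^-1 * I * m).
    rewrite expr2 -!mulrA (mulVKr mU) (mulrA I) -expr2 I2 -scalerAl mul1r.
    by rewrite -scalerAr mulVr.
  by rewrite !mulrA jm -!mulrA -Jm (mulrA J) JI mulNr mulrN !mulrA.
have [w [x [y [z E]]]] := comb_exists base' I'.
have jE : j' = comb i' j' 0 0 1 0 by rewrite /comb !scale0r scale1r !addr0 add0r.
move: jI'; rewrite [X in X * I']jE [X in - (_ * X)]jE E !(combM i2' j2' ji').
rewrite -scaleN1r combZ => /(comb_inj base')[e0 _ e2 _].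
have double0 (p : K) : 2%:R * p = 0 -> p = 0.
  by move=> /eqP; rewrite mulf_eq0 (negPf two_neq0) => /eqP.
have y0 : y = 0.
  apply: (mulfI bN0); rewrite mulr0; apply: double0; apply/eqP; move/eqP: e0.
  by rewrite -subr_eq0; congr (_ == 0); ring.
have w0 : w = 0.
  apply: double0; apply/eqP; move/eqP: e2.
  by rewrite -subr_eq0; congr (_ == 0); ring.
move: I2'; rewrite E w0 y0 (pure_sqr i2' j2' ji').
rewrite -(comb_scalar i' j') -(comb_scalar i' j' a).
move/(comb_inj base') => [aE _ _ _].
have [|_ one0 _ _] := ns (a' * x) 1 (a' * z) 0; first by rewrite -aE; ring.
by case/eqP: (oner_neq0 K).
Qed.

(** * The fields of the theorem *)

Lemma nonsplit_neq0 (K : fieldType) (a b : K) : nonsplit a b -> a != 0 /\ b != 0.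
Proof.
move=> /nonsplitP ns; split; apply/eqP => z0.
  have [|_ /eqP] := ns 0 1 0 0; first by rewrite z0; ring.
  by rewrite oner_eq0.
have [|_ _ /eqP] := ns 0 0 1 0; first by rewrite z0; ring.
by rewrite oner_eq0.
Qed.

Lemma Quat_quat (K : fieldType) (a b : K) :
  (2%:R : K) != 0 -> nonsplit a b -> Quat (quat a b : falgType K).
Proof.
move=> two_neq0 ns; have [aN0 bN0] := nonsplit_neq0 ns.
split; last by split; [exact: quat_division | exact: quat_central].
have [i2 j2 ji base] := quat_generators a b.
by exists a, b, (quat_i a b), (quat_j a b).
Qed.

Lemma quat_not_isomorphic (K : fieldType) (a a' b : K) :
  (2%:R : K) != 0 -> nonsplit a' b -> nonsplit (a * a') b ->
  ~ alg_isomorphic (quat a b : falgType K) (quat a' b : falgType K).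
Proof.
move=> two_neq0 ns nsM iso; have [aN0' bN0] := nonsplit_neq0 ns.
have [i2 j2 ji _] := quat_generators a b.
have [i2' j2' ji' base'] := quat_generators a' b.
exact: (common_slot_split two_neq0 aN0' bN0 i2 j2 ji i2' j2' ji' base'
         (quat_division ns) iso nsM).
Qed.

(** K is the slot closure of a field with independent symbols.  The symbols stay
    nonisomorphic because this is witnessed by the division algebras
    (a_m a_n, t), which the closure preserves. *)
Theorem weakly_isomorphic_field (p : nat) : prime p -> odd p ->
  exists K : fieldType, p \in [pchar K] /\
    [/\ 2%N \notin [pchar K],
        infinite_up_to (@alg_isomorphic K) (@Quat K)
      & forall D D' : falgType K, Quat D -> Quat D' -> weakly_isomorphic D D'].
Proof.
move=> p_pr p_odd.
have [K0 [a [t [charK0 enK0 ns nsM]]]] := independent_symbols p_pr.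
have two0 (F : fieldType) : p \in [pchar F] -> (2%:R : F) != 0.
  move=> cF; rewrite -(dvdn_pcharf cF) dvdn_prime2 //.
  by apply: contraL p_odd => /eqP ->.
have [K [f [keep slots]]] := slot_closure enK0 (two0 _ charK0).
have charK := pchar_rmorph f charK0; have two_neq0 := two0 _ charK.
exists K; split=> //; split.
- by rewrite inE /= two_neq0.
- exists (fun n => quat (f (a n)) (f t) : falgType K); split=> [n|m n nmn].
    by apply: Quat_quat => //; apply: keep.
  apply: quat_not_isomorphic => //; first exact: keep.
  by rewrite -rmorphM; apply/keep/nsM.
by move=> D D' qD qD' L; split; apply: Max_transfer.
Qed.

Theorem corollary4p4 :
  infinite_up_to field_isomorphic (fun K : fieldType =>
    [/\ 2%N \notin [pchar K]%R,
        infinite_up_to (@alg_isomorphic K) (@Quat K)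
      & forall D D' : falgType K,
          Quat D -> Quat D' -> weakly_isomorphic D D']).
Proof.
(* A strictly increasing sequence of odd primes, the characteristics. *)
pose fix q n := if n is m.+1 then s2val (prime_above (q m)) else 3%N.
have q_prime n : prime (q n) by case: n => //= n; case: prime_above.
have q_mono : {homo q : m n / (m < n)%N}.
  by apply: homo_ltn => [|n /=]; [exact: ltn_trans | case: prime_above].
have q_odd n : odd (q n).
  case: (even_prime (q_prime n)) => // q2.
  by case: n q2 => // n q2; have := q_mono 0%N n.+1 isT; rewrite q2.
have [K KP] := choice (fun n => weakly_isomorphic_field (q_prime n) (q_odd n)).
exists K; split=> [n|m n nmn [f _]]; first by have [_ []] := KP n.
have [chm _] := KP m; have [chn _] := KP n.
have := pchar_rmorph f chm; rewrite (pcharf_eq chn) => /eqP e.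
case: (ltngtP m n) nmn => // lt _; have := q_mono _ _ lt; rewrite e ltnn //.
Qed.
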